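(* Let $M=N_T\times_f N_\theta$ be a warped product semi-slant submanifold of a nearly trans-Sasakian manifold $(\bar M,\phi,\xi,\eta,g)$ of type $(\alpha,\beta)$ such that $\xi$ is tangent to $N_T$, where $N_T$ and $N_\theta$ are invariant and proper slant submanifolds (with slant angle $\theta$) of dimensions $2s+1$ and $2q$, respectively. Then: (i) the second fundamental form $h$ of $M$ satisfies $$\|h\|^2\ \ge\ 2q\Big[\Big\{\tfrac29\cot^2\theta+2\csc^2\theta\Big\}\big(\|\mathrm{grad}(\ln f)\|^2-\beta^2\big)+\alpha^2\Big];$$ (ii) if the equality sign in (i) holds identically, then $N_T$ and $N_\theta$ are totally geodesic and totally umbilical submanifolds in $\bar M$, respectively.
   Context: An almost contact metric manifold is a $(2m+1)$-dimensional smooth manifold $\bar M$ with a $(1,1)$-tensor field $\phi$, a vector field $\xi$, a $1$-form $\eta$ and a Riemannian metric $g$ satisfying $\phi^2=-I+\eta\otimes\xi$, $\phi\xi=0$, $\eta\circ\phi=0$, $\eta(\xi)=1$, $\eta(X)=g(X,\xi)$ and $g(\phi X,\phi Y)=g(X,Y)-\eta(X)\eta(Y)$ for all vector fields $X,Y$ on $\bar M$. Let $\bar\nabla$ be the Levi-Civita connection of $g$. The structure is nearly trans-Sasakian of type $(\alpha,\beta)$ ($\alpha,\beta$ smooth functions on $\bar M$) if for all vector fields $X,Y$ on $\bar M$ $$(\bar\nabla_X\phi)Y+(\bar\nabla_Y\phi)X=\alpha\big(2g(X,Y)\xi-\eta(Y)X-\eta(X)Y\big)-\beta\big(\eta(Y)\phi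 X+\eta(X)\phi Y\big).$$ For Riemannian manifolds $(N_1,g_1)$, $(N_2,g_2)$ and a positive differentiable function $f$ on $N_1$, the warped product $N_1\times_f N_2$ is the product manifold $N_1\times N_2$ with the metric $\|X\|^2=\|\pi_{1\star}X\|^2+(f\circ\pi_1)^2\|\pi_{2\star}X\|^2$, where $\pi_1,\pi_2$ are the projections; $f$ is identified with $f\circ\pi_1$. A warped product semi-slant submanifold of type $N_T\times_f N_\theta$ is a submanifold $M$ of $\bar M$, with $\xi$ tangent to $M$, which with the induced metric (also denoted $g$) is a warped product $N_T\times_f N_\theta$ such that: $N_T$ is an invariant submanifold ($\phi(TN_T)\subseteq TN_T$), and $N_\theta$ is a proper slant submanifold with slant angle $\theta\in(0,\pi/2)$, i.e. for every nonzero vector $Z$ tangent to $N_\theta$ and not proportional to $\xi$, the angle between $\phi Z$ and the tangent space of $N_\theta$ is the constant $\theta$. ''$\xi$ is tangent to $N_T$'' means that along $M$ the vector field $\xi$ lies in the subbundle of $TM$ tangent to the factor $N_T$. The second fundamental form $h$ is defined by $\bar\nabla_XY=\nabla_XY+h(X,Y)$ for $X,Y$ tangent to $M$, with $\nabla$ the Levi-Civita connection of $M$, and $\|h\|^2=\sum_{i,j=1}^n g(h(e_i,e_j),h(e_i,e_j))$ for a local orthonormal frame $e_1,\dots,e_n$ of $TM$, $n=\dim M$. The gradient is defined by $g(\mathrm{grad}\,\psi,X)=X\psi$. A submanifold is totally geodesic if its second fundamental form vanishes, and totally umbilical if its second fundamental form satisfies $h(X,Y)=g(X,Y)H$ with $H$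 its mean curvature vector. *)

(* Defs.v *)
From HB Require Import structures.
From mathcomp Require Import all_boot all_order all_algebra.
From mathcomp Require Import all_classical all_reals all_analysis.
From mathcomp Require Import ring.

Set Implicit Arguments.
Unset Strict Implicit.
Unset Printing Implicit Defensive.
Import Order.TTheory GRing.Theory Num.Theory.
Import numFieldNormedType.Exports.
Local Open Scope classical_set_scope.
Local Open Scope ring_scope.

(* Vectors are row vectors, so matrices of linear maps act on the right:
   'd F x u = u *m 'J F x. *)

Definition ebase (R : realType) n (i : 'I_n) : 'rV[R]_n := delta_mx 0 i.

Definition iter_partial (R : realType) n (s : seq 'I_n) (f : 'rV[R]_n -> R) :
    'rV[R]_n -> R :=
  foldr (fun i h => 'D_(ebase R i) h) f s.

(* C^infinity on U: the iterated partial derivatives of all orders are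
   (Frechet) differentiable at every point of U. *)
Definition smooth_on (R : realType) n (U : set 'rV[R]_n) (f : 'rV[R]_n -> R) :=
  forall s x, U x -> differentiable (iter_partial s f) x.

Definition smooth_mx_on (R : realType) n a b (U : set 'rV[R]_n)
    (f : 'rV[R]_n -> 'M[R]_(a, b)) :=
  forall i j, smooth_on U (fun x => f x i j).

(** * Manifolds *)

(* A space with an atlas. [chart_map c] is meaningful only on [chart_dom c], and
   its inverse [chart_inv c] only on the image. *)
Record charted (R : realType) (n : nat) := Charted {
  space :> topologicalType;
  chart : Type;
  chart_dom : chart -> set space;
  chart_map : chart -> space -> 'rV[R]_n;
  chart_inv : chart -> 'rV[R]_n -> space }.

Definition chart_img (R : realType) n (M : charted R n) (c : chart M) :
  set 'rV[R]_n := chart_map c @` chart_dom c.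

(* A map read in the charts c and d, and the set on which this makes sense. *)
Definition local_rep (R : realType) n n' (M : charted R n) (M' : charted R n')
    (F : M -> M') (c : chart M) (d : chart M') : 'rV[R]_n -> 'rV[R]_n' :=
  fun x => chart_map d (F (chart_inv c x)).

Definition rep_dom (R : realType) n n' (M : charted R n) (M' : charted R n')
    (F : M -> M') (c : chart M) (d : chart M') : set 'rV[R]_n :=
  [set x | chart_img c x /\ chart_dom d (F (chart_inv c x))].

Record smooth_manifold (R : realType) n (M : charted R n) : Prop := {
  mfd_hausdorff : hausdorff_space M;
  mfd_countable : @second_countable M;
  mfd_cover : forall p : M, exists c : chart M, chart_dom c p;
  mfd_dom_open : forall c : chart M, open (chart_dom c);
  mfd_img_open : forall c : chart M, open (chart_img c);
  mfd_coordK : forall (c : chart M) p, chart_dom c p ->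
    chart_inv c (chart_map c p) = p;
  mfd_coord_cont : forall (c : chart M) p, chart_dom c p ->
    {for p, continuous (chart_map c)};
  mfd_point_cont : forall (c : chart M) x, chart_img c x ->
    {for x, continuous (chart_inv c)};
  mfd_smooth : forall c d : chart M,
    smooth_mx_on (rep_dom id c d) (local_rep id c d) }.

Definition smooth_fun (R : realType) n (M : charted R n) (f : M -> R) :=
  forall c : chart M, smooth_on (chart_img c) (fun x => f (chart_inv c x)).

Definition smooth_map (R : realType) n n' (M : charted R n) (M' : charted R n')
    (F : M -> M') :=
  continuous F /\ forall c d, smooth_mx_on (rep_dom F c d) (local_rep F c d).

Definition immersion (R : realType) n n' (M : charted R n) (M' : charted R n')
    (F : M -> M') :=
  smooth_map F /\ forall c d x, rep_dom F c d x ->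
    injective (fun u : 'rV[R]_n => u *m 'J (local_rep F c d) x).

Definition prod_charted (R : realType) n1 n2
    (N1 : charted R n1) (N2 : charted R n2) : charted R (n1 + n2) :=
  @Charted R (n1 + n2) (N1 * N2)%type (chart N1 * chart N2)%type
    (fun c => chart_dom c.1 `*` chart_dom c.2)
    (fun c p => row_mx (chart_map c.1 p.1) (chart_map c.2 p.2))
    (fun c x => (chart_inv c.1 (lsubmx x), chart_inv c.2 (rsubmx x))).

(** * Tensor fields *)

(* Classical definition: a tensor field is given by its components in every
   chart, subject to the transformation laws under a change of chart. *)
Section tensors.
Context (R : realType) (n : nat) (M : charted R n).

Definition vector_field (X : chart M -> 'rV[R]_n -> 'rV[R]_n) :=
  (forall c, smooth_mx_on (chart_img c) (X c)) /\
  forall c d x, rep_dom id c d x ->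
    X d (local_rep id c d x) = X c x *m 'J (local_rep id c d) x.

(* the value of the form w on the vector v is (v *m w) 0 0 *)
Definition one_form (w : chart M -> 'rV[R]_n -> 'cV[R]_n) :=
  (forall c, smooth_mx_on (chart_img c) (w c)) /\
  forall c d x, rep_dom id c d x ->
    w c x = 'J (local_rep id c d) x *m w d (local_rep id c d x).

Definition endo_field (P : chart M -> 'rV[R]_n -> 'M[R]_n) :=
  (forall c, smooth_mx_on (chart_img c) (P c)) /\
  forall c d x, rep_dom id c d x ->
    P c x *m 'J (local_rep id c d) x =
      'J (local_rep id c d) x *m P d (local_rep id c d x).

End tensors.

Definition ip (R : realType) n (G : 'M[R]_n) (u v : 'rV[R]_n) : R :=
  (u *m G *m v^T) 0 0.

Definition mnorm (R : realType) n (G : 'M[R]_n) (u : 'rV[R]_n) : R :=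
  Num.sqrt (ip G u u).

Definition orthonormal_frame (R : realType) n (G : 'M[R]_n)
    (e : 'I_n -> 'rV[R]_n) :=
  forall i j, ip G (e i) (e j) = (i == j)%:R.

Record riemannian_metric (R : realType) n (M : charted R n)
    (g : chart M -> 'rV[R]_n -> 'M[R]_n) : Prop := {
  metric_smooth : forall c, smooth_mx_on (chart_img c) (g c);
  metric_compat : forall c d x, rep_dom id c d x ->
    g c x = 'J (local_rep id c d) x *m g d (local_rep id c d x)
              *m ('J (local_rep id c d) x)^T;
  metric_sym : forall c x, chart_img c x -> (g c x)^T = g c x;
  metric_pos : forall c x, chart_img c x ->
    forall u, u != 0 -> 0 < ip (g c x) u u }.

(** * Riemannian geometry in a coordinate domain *)

Section local_geometry.
Context (R : realType).

(* Koszul's formula on constant fields determines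
     2 g(Gamma(u, v), w) = u g(v, w) + v g(u, w) - w g(u, v). *)
Definition christoffel n (G : 'rV[R]_n -> 'M[R]_n) (x u v : 'rV[R]_n) :
    'rV[R]_n :=
  (\row_k (2^-1 * ('D_u (fun y => ip (G y) v (ebase R k)) x
                   + 'D_v (fun y => ip (G y) u (ebase R k)) x
                   - 'D_(ebase R k) (fun y => ip (G y) u v) x)))
  *m invmx (G x).

(* Levi-Civita derivative of the field Y in the direction u; see
   [levi_civita_torsion_free] and [levi_civita_metric] below. *)
Definition levi_civita n (G : 'rV[R]_n -> 'M[R]_n) (u : 'rV[R]_n)
    (Y : 'rV[R]_n -> 'rV[R]_n) (x : 'rV[R]_n) : 'rV[R]_n :=
  'D_u Y x + christoffel G x u (Y x).

(* The same connection acting on a field V along a map F. *)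
Definition levi_civita_along n n' (G : 'rV[R]_n' -> 'M[R]_n')
    (F : 'rV[R]_n -> 'rV[R]_n') (u : 'rV[R]_n) (V : 'rV[R]_n -> 'rV[R]_n')
    (x : 'rV[R]_n) : 'rV[R]_n' :=
  'D_u V x + christoffel G (F x) (u *m 'J F x) (V x).

Definition induced_metric n n' (G : 'rV[R]_n' -> 'M[R]_n')
    (F : 'rV[R]_n -> 'rV[R]_n') (x : 'rV[R]_n) : 'M[R]_n :=
  'J F x *m G (F x) *m ('J F x)^T.

(* Gauss formula: h(u, v) is the ambient derivative minus the image of the
   intrinsic one. As h is tensorial, v is extended as a constant field. *)
Definition second_ff n n' (G : 'rV[R]_n' -> 'M[R]_n')
    (F : 'rV[R]_n -> 'rV[R]_n') (x u v : 'rV[R]_n) : 'rV[R]_n' :=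
  levi_civita_along G F u (fun y => v *m 'J F y) x
  - levi_civita (induced_metric G F) u (fun=> v) x *m 'J F x.

(* squared norm of h computed in the frame e *)
Definition second_ff_norm2 n n' (G : 'rV[R]_n' -> 'M[R]_n')
    (F : 'rV[R]_n -> 'rV[R]_n') (x : 'rV[R]_n) (e : 'I_n -> 'rV[R]_n) : R :=
  \sum_(i < n) \sum_(j < n)
    ip (G (F x)) (second_ff G F x (e i) (e j)) (second_ff G F x (e i) (e j)).

Definition mean_curvature n n' (G : 'rV[R]_n' -> 'M[R]_n')
    (F : 'rV[R]_n -> 'rV[R]_n') (x : 'rV[R]_n) (e : 'I_n -> 'rV[R]_n) :
    'rV[R]_n' :=
  n%:R^-1 *: \sum_(i < n) second_ff G F x (e i) (e i).

(* characterized by [gradientP] below *)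
Definition gradient n (G : 'rV[R]_n -> 'M[R]_n) (psi : 'rV[R]_n -> R)
    (x : 'rV[R]_n) : 'rV[R]_n :=
  (\row_k 'D_(ebase R k) psi x) *m invmx (G x).

(* theta is the angle between w and its orthogonal projection t on V *)
Definition angle_with n (G : 'M[R]_n) (w : 'rV[R]_n) (V : set 'rV[R]_n)
    (theta : R) :=
  exists t, [/\ V t, forall v, V v -> ip G (w - t) v = 0 &
                theta = acos (mnorm G t / mnorm G w)].

End local_geometry.

(** * The connection is torsion-free and metric *)

Section levi_civita_facts.
Context (R : realType) (n : nat).
Implicit Types (G : 'rV[R]_n -> 'M[R]_n) (X Y Z : 'rV[R]_n -> 'rV[R]_n).
Implicit Types x u v w : 'rV[R]_n.

Fact ipE (A : 'M[R]_n) u v :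
  ip A u v = \sum_j \sum_i u 0 i * A i j * v 0 j.
Proof.
rewrite /ip mxE; apply: eq_bigr => j _; rewrite !mxE mulr_suml.
by apply: eq_bigr.
Qed.

Fact ip_sym (A : 'M[R]_n) u v : A^T = A -> ip A u v = ip A v u.
Proof.
move=> As; rewrite /ip -[in LHS]As -[u]trmxK -!trmx_mul trmxK.
by rewrite mxE mulmxA.
Qed.

Fact ip_invmx (A : 'M[R]_n) (a w : 'rV[R]_n) : A \in unitmx ->
  ip A (a *m invmx A) w = \sum_k w 0 k * a 0 k.
Proof.
move=> Au; rewrite /ip mulmxKV// mxE.
by apply: eq_bigr => k _; rewrite mxE mulrC.
Qed.

Fact is_derive_ip G Y Z x u :
    derivable G x u -> derivable Y x u -> derivable Z x u ->
  is_derive x u (fun y => ip (G y) (Y y) (Z y))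
    (ip ('D_u G x) (Y x) (Z x) + ip (G x) ('D_u Y x) (Z x)
    + ip (G x) (Y x) ('D_u Z x)).
Proof.
move=> dG dY dZ.
have hG i j := derivableP ((derivable_mxP G x u).1 dG i j).
have hY i := derivableP ((derivable_mxP Y x u).1 dY 0 i).
have hZ j := derivableP ((derivable_mxP Z x u).1 dZ 0 j).
rewrite (derive_mx dG) (derive_mx dY) (derive_mx dZ) !ipE -!big_split/=.
rewrite [X in is_derive _ _ X _](_ : _ = \sum_j \sum_i
  ((fun y => Y y 0 i) * (fun y => G y i j) * (fun y => Z y 0 j))); last first.
  apply/funext => y; rewrite ipE fct_sumE; apply: eq_bigr => j _.
  by rewrite fct_sumE.
apply: is_derive_sum => j; rewrite -!big_split/=.
apply: is_derive_sum => i.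
apply: (is_derive_eq (is_deriveM (is_deriveM (hY i) (hG i j)) (hZ j))).
have key (a b c a' b' c' : R) : (a * b) * c' + c * (a * b' + b * a') =
    a * b' * c + a' * b * c + a * b * c' by ring.
by rewrite !mxE; exact: key.
Qed.

Fact derive_ip G Y Z x u :
    derivable G x u -> derivable Y x u -> derivable Z x u ->
  'D_u (fun y => ip (G y) (Y y) (Z y)) x =
    ip ('D_u G x) (Y x) (Z x) + ip (G x) ('D_u Y x) (Z x)
    + ip (G x) (Y x) ('D_u Z x).
Proof. by move=> dG dY dZ; have [_ ->] := is_derive_ip dG dY dZ. Qed.

Fact derive_ip_cst G x u v w : derivable G x u ->
  'D_u (fun y => ip (G y) v w) x = ip ('D_u G x) v w.
Proof.
move=> dG; rewrite (@derive_ip G (cst v) (cst w))//; try exact: derivable_cst.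
have ip0l (A : 'M[R]_n) a : ip A 0 a = 0 by rewrite /ip !mul0mx mxE.
have ip0r (A : 'M[R]_n) a : ip A a 0 = 0 by rewrite /ip trmx0 mulmx0 mxE.
by rewrite !derive_cst ip0l ip0r !addr0.
Qed.

Fact ip_ebase (A : 'M[R]_n) u w : ip A u w = \sum_k w 0 k * ip A u (ebase R k).
Proof.
rewrite {1}[w]row_sum_delta /ip linear_sum mulmx_sumr summxE.
by apply: eq_bigr => k _; rewrite linearZ/= -scalemxAr mxE.
Qed.

(* The defining identity of [christoffel]. *)
Fact christoffelP G x u v w : differentiable G x -> G x \in unitmx ->
  ip (G x) (christoffel G x u v) w =
  2^-1 * ('D_u (fun y => ip (G y) v w) x + 'D_v (fun y => ip (G y) u w) x
          - 'D_w (fun y => ip (G y) u v) x).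
Proof.
move=> dG Gu; have dG' z : derivable G x z by exact: diff_derivable.
rewrite ip_invmx// !derive_ip_cst// (ip_ebase _ v w) (ip_ebase _ u w).
have -> : ip ('D_w G x) u v = \sum_k w 0 k * ip ('D_(ebase R k) G x) u v.
  rewrite (deriveE _ dG) {1}[w]row_sum_delta linear_sum.
  rewrite /ip mulmx_sumr mulmx_suml.
  rewrite summxE; apply: eq_bigr => k _.
  by rewrite linearZ/= -scalemxAr -scalemxAl mxE (deriveE _ dG).
rewrite -big_split/= -sumrB mulr_sumr; apply: eq_bigr => k _.
by rewrite mxE !derive_ip_cst//; ring.
Qed.

Fact levi_civita_torsion_free G X Y x :
    (\forall y \near x, (G y)^T = G y) ->
  levi_civita G (X x) Y x - levi_civita G (Y x) X x
  = 'D_(X x) Y x - 'D_(Y x) X x.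
Proof.
move=> Gs; rewrite /levi_civita (_ : christoffel G x (Y x) (X x) =
    christoffel G x (X x) (Y x)); first by rewrite opprD addrACA subrr addr0.
rewrite /christoffel; congr (_ *m _); apply/rowP => k; rewrite !mxE.
congr (_ * (_ - _)); first by rewrite addrC.
apply: near_eq_derive; near=> y; apply: ip_sym.
by near: y.
Unshelve. all: by end_near. Qed.

Fact levi_civita_metric G Y Z x u :
    (\forall y \near x, (G y)^T = G y) -> G x \in unitmx ->
    differentiable G x -> derivable Y x u -> derivable Z x u ->
  'D_u (fun y => ip (G y) (Y y) (Z y)) x =
    ip (G x) (levi_civita G u Y x) (Z x) + ip (G x) (Y x) (levi_civita G u Z x).
Proof.
move=> Gs Gu dG dY dZ; have dG' z : derivable G x z by exact: diff_derivable.
have Gx : (G x)^T = G x by exact: nbhs_singleton Gs.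
have Ds a b c : 'D_a (fun y => ip (G y) b c) x = 'D_a (fun y => ip (G y) c b) x.
  by apply: near_eq_derive; near=> y; apply: ip_sym; near: y.
rewrite derive_ip// (ip_sym (Y x) (levi_civita _ _ _ _) Gx).
have ipD a b c : ip (G x) (a + b) c = ip (G x) a c + ip (G x) b c.
  by rewrite /ip !mulmxDl mxE.
rewrite /levi_civita !ipD !christoffelP// (ip_sym ('D_u Z x) _ Gx).
rewrite (Ds (Z x) u) (Ds (Y x) u) (Ds u (Z x)).
have key (a b c p r : R) : a + p + r =
    p + 2^-1 * (a + c - b) + (r + 2^-1 * (a + b - c)) by field.
by rewrite -derive_ip_cst//; exact: key.
Unshelve. all: by end_near. Qed.

Fact gradientP G psi x w : differentiable psi x -> G x \in unitmx ->
  ip (G x) (gradient G psi x) w = 'D_w psi x.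
Proof.
move=> dpsi Gu; rewrite ip_invmx// (deriveE _ dpsi).
rewrite {2}[w]row_sum_delta linear_sum.
by apply: eq_bigr => k _; rewrite linearZ/= mxE (deriveE _ dpsi).
Qed.

End levi_civita_facts.

(** * Submanifolds of a Riemannian manifold *)

Section submanifolds.
Context (R : realType) (n n' : nat) (N : charted R n) (M : charted R n').
Context (g : chart M -> 'rV[R]_n' -> 'M[R]_n') (F : N -> M).

Definition totally_geodesic :=
  forall c d x, rep_dom F c d x ->
  forall u v, second_ff (g d) (local_rep F c d) x u v = 0.

Definition totally_umbilical :=
  forall c d x, rep_dom F c d x ->
  forall e, orthonormal_frame (induced_metric (g d) (local_rep F c d) x) e ->
  forall u v, second_ff (g d) (local_rep F c d) x u v =
    ip (induced_metric (g d) (local_rep F c d) x) u v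
      *: mean_curvature (g d) (local_rep F c d) x e.

End submanifolds.

(** * Almost contact metric structures *)

Record contact_data (R : realType) n (M : charted R n) := ContactData {
  phi : chart M -> 'rV[R]_n -> 'M[R]_n;
  xi : chart M -> 'rV[R]_n -> 'rV[R]_n;
  eta : chart M -> 'rV[R]_n -> 'cV[R]_n;
  gmet : chart M -> 'rV[R]_n -> 'M[R]_n }.

Section contact.
Context (R : realType) (n : nat) (M : charted R n) (S : contact_data M).

Let phi_ c x (u : 'rV[R]_n) := u *m phi S c x.
Let eta_ c x (u : 'rV[R]_n) := (u *m eta S c x) 0 0.
Let g_ c x := ip (gmet S c x).

Record almost_contact_metric : Prop := {
  acm_phi : endo_field (phi S);
  acm_xi : vector_field (xi S);
  acm_eta : one_form (eta S);
  acm_metric : riemannian_metric (gmet S);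
  acm_phi2 : forall c x, chart_img c x -> forall u,
    phi_ c x (phi_ c x u) = - u + eta_ c x u *: xi S c x;
  acm_phi_xi : forall c x, chart_img c x -> phi_ c x (xi S c x) = 0;
  acm_eta_phi : forall c x, chart_img c x -> forall u,
    eta_ c x (phi_ c x u) = 0;
  acm_eta_xi : forall c x, chart_img c x -> eta_ c x (xi S c x) = 1;
  acm_eta_dual : forall c x, chart_img c x -> forall u,
    eta_ c x u = g_ c x u (xi S c x);
  acm_phi_metric : forall c x, chart_img c x -> forall u v,
    g_ c x (phi_ c x u) (phi_ c x v) = g_ c x u v - eta_ c x u * eta_ c x v }.

(* (nabla_X phi) Y = nabla_X (phi Y) - phi (nabla_X Y) *)
Definition nabla_phi c (X Y : 'rV[R]_n -> 'rV[R]_n) (x : 'rV[R]_n) : 'rV[R]_n :=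
  levi_civita (gmet S c) (X x) (fun y => phi_ c y (Y y)) x
  - phi_ c x (levi_civita (gmet S c) (X x) Y x).

(* The identity is local, and X, Y range over the vector fields on the domain
   of an arbitrary chart. *)
Definition nearly_trans_sasakian (alpha beta : M -> R) :=
  forall c (X Y : 'rV[R]_n -> 'rV[R]_n),
    smooth_mx_on (chart_img c) X -> smooth_mx_on (chart_img c) Y ->
  forall x, chart_img c x ->
    nabla_phi c X Y x + nabla_phi c Y X x =
      alpha (chart_inv c x) *: ((2 * g_ c x (X x) (Y x)) *: xi S c x
        - eta_ c x (Y x) *: X x - eta_ c x (X x) *: Y x)
      - beta (chart_inv c x) *: (eta_ c x (Y x) *: phi_ c x (X x)
        + eta_ c x (X x) *: phi_ c x (Y x)).

Context (k : nat) (N : charted R k) (F : N -> M).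

Definition xi_tangent :=
  forall c d x, rep_dom F c d x ->
  exists u, xi S d (local_rep F c d x) = u *m 'J (local_rep F c d) x.

Definition invariant_submanifold :=
  forall c d x, rep_dom F c d x ->
  forall u, exists v,
    phi_ d (local_rep F c d x) (u *m 'J (local_rep F c d) x) =
      v *m 'J (local_rep F c d) x.

Definition slant_submanifold (theta : R) :=
  forall c d x, rep_dom F c d x ->
  let y := local_rep F c d x in
  let J := 'J (local_rep F c d) x in
  forall u, u *m J != 0 -> (forall a, u *m J != a *: xi S d y) ->
  angle_with (gmet S d y) (phi_ d y (u *m J)) [set v *m J | v in setT] theta.

End contact.

(** * Warped product semi-slant submanifolds *)

Section warped.
Context (R : realType) (n n1 n2 : nat).
Context (M : charted R n) (N1 : charted R n1) (N2 : charted R n2).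

Definition leaf1 (F : prod_charted N1 N2 -> M) (p2 : N2) : N1 -> M :=
  fun p1 => F (p1, p2).
Definition leaf2 (F : prod_charted N1 N2 -> M) (p1 : N1) : N2 -> M :=
  fun p2 => F (p1, p2).

(* The metric induced by F is that of the warped product N1 x_f N2. *)
Definition warped_metric (g : chart M -> 'rV[R]_n -> 'M[R]_n)
    (g1 : chart N1 -> 'rV[R]_n1 -> 'M[R]_n1)
    (g2 : chart N2 -> 'rV[R]_n2 -> 'M[R]_n2) (f : N1 -> R)
    (F : prod_charted N1 N2 -> M) :=
  forall (c : chart (prod_charted N1 N2)) d x, rep_dom F c d x ->
  forall u,
    ip (induced_metric (g d) (local_rep F c d) x) u u =
      ip (g1 c.1 (lsubmx x)) (lsubmx u) (lsubmx u)
      + f (chart_inv c.1 (lsubmx x)) ^+ 2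
        * ip (g2 c.2 (rsubmx x)) (rsubmx u) (rsubmx u).

(* Submanifolds are immersed. N1 and N2, as submanifolds of M, are the leaves
   N1 x {p2} and {p1} x N2. *)
Record warped_semi_slant (S : contact_data M)
    (g1 : chart N1 -> 'rV[R]_n1 -> 'M[R]_n1)
    (g2 : chart N2 -> 'rV[R]_n2 -> 'M[R]_n2) (f : N1 -> R) (theta : R)
    (F : prod_charted N1 N2 -> M) : Prop := {
  wss_manifold1 : smooth_manifold N1;
  wss_manifold2 : smooth_manifold N2;
  wss_metric1 : riemannian_metric g1;
  wss_metric2 : riemannian_metric g2;
  wss_f_smooth : smooth_fun f;
  wss_f_pos : forall p, 0 < f p;
  wss_immersion : immersion F;
  wss_xi : xi_tangent S F;
  wss_warped : warped_metric (gmet S) g1 g2 f F;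
  wss_invariant : forall p2, invariant_submanifold S (leaf1 F p2);
  wss_theta : 0 < theta < pi / 2;
  wss_slant : forall p1, slant_submanifold S (leaf2 F p1) theta }.

End warped.

Definition csc (R : realType) (t : R) : R := (sin t)^-1.
Definition cot (R : realType) (t : R) : R := cos t / sin t.

(* Main.v *)
Require Import Defs.
From HB Require Import structures.
From mathcomp Require Import all_boot all_order all_algebra.
From mathcomp Require Import all_classical all_reals all_analysis.
From mathcomp Require Import ring lra.
Set Implicit Arguments.
Unset Strict Implicit.
Unset Printing Implicit Defensive.
Import Order.TTheory GRing.Theory Num.Theory.
Import numFieldNormedType.Exports.
Local Open Scope classical_set_scope.
Local Open Scope ring_scope.

(** Everything happens at one point, in coordinates. Let [X] be tangent to the
    first factor, [Z] and [W] to the second, [h] the second fundamental form of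
    the immersion and [om Z W = g (phi Z) W] the fundamental form of the second
    factor. Koszul's formula for the warped metric says that the ambient
    derivative of [Z] along [X] is [(X ln f) Z + h (X, Z)], and that the part of
    the derivative of [W] along [Z] tangent to the first factor is
    [- g (Z, W) grad (ln f)] ([coord_deriv_mixed], [coord_deriv_ver_hor]).

    Put [H Z W = g (h (X, Z)) (phi W)]. Differentiating [g (phi X) W = 0] along
    the second factor expresses [(nabla_Z phi) X] by [H], and differentiating
    [om] along the first factor expresses [(nabla_X phi) Z] by [H]. The nearly
    trans-Sasakian identity prescribes the sum of both ([nts_mixed]):
      [q Z W + 2 H Z W - H W Z + mu g (Z, W) = nu om Z W]
    where [mu = (phi X) ln f + alpha eta X], [nu = X ln f - beta eta X] and [q]
    is the covariant derivative of [om] along [X]. As [om] and [q] are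
    antisymmetric, the symmetric part of [H] is [- mu g] and its antisymmetric
    part is [(nu om - q) / 3]. The form [q] is not claimed to vanish:
    a priori the position of [phi Z] relative to the second factor may depend on
    the point of the first one. But the slant condition fixes the length
    [cos theta |Z|] of [om Z], and its derivative along [X] says that [q] is
    orthogonal to [om] ([cov_slant_orthogonal]); hence [q] can only increase the
    norm of [H] ([sum_sqr_lower]).

    Since [h] is normal, [H] only sees the normal part of [phi W], which has
    length [sin theta |W|], and Bessel's inequality turns the bound on [H] into
    one on [|h (X, Z)|^2] ([mixed_ff_bessel]). Summing over an orthonormal frame
    of the first factor, the squares of [mu] add up to
    [|grad (ln f)|^2 - beta^2 + alpha^2] and those of [nu] to
    [|grad (ln f)|^2 - beta^2], because [xi (ln f) = beta] ([dlnf_xi]). Counted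
    twice, by the symmetry of [h], the mixed block of [|h|^2] already reaches
    the bound ([mixed_block_lower]).

    In the case of equality the two pure blocks of [|h|^2] vanish. The second
    fundamental form of a factor is then that of the factor inside the warped
    product: zero for the first one, which is totally geodesic there, and
    [- g (Z, W) grad (ln f)] for the second one. *)

(** * Inner products and orthonormal frames *)

Section inner_product.
Context (R : realType) (n : nat).
Implicit Types (A : 'M[R]_n) (u v w : 'rV[R]_n).

Lemma ipDl A u v w : ip A (u + v) w = ip A u w + ip A v w.
Proof. by rewrite /ip !mulmxDl mxE. Qed.

Lemma ipDr A u v w : ip A u (v + w) = ip A u v + ip A u w.
Proof. by rewrite /ip linearD mulmxDr mxE. Qed.

Lemma ipZl A a u v : ip A (a *: u) v = a * ip A u v.
Proof. by rewrite /ip -!scalemxAl mxE. Qed.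

Lemma ipZr A a u v : ip A u (a *: v) = a * ip A u v.
Proof. by rewrite /ip linearZ -scalemxAr mxE. Qed.

Lemma ipNl A u v : ip A (- u) v = - ip A u v.
Proof. by rewrite -scaleN1r ipZl mulN1r. Qed.

Lemma ipNr A u v : ip A u (- v) = - ip A u v.
Proof. by rewrite -scaleN1r ipZr mulN1r. Qed.

Lemma ip0l A u : ip A 0 u = 0.
Proof. by rewrite /ip !mul0mx mxE. Qed.

Lemma ip0r A u : ip A u 0 = 0.
Proof. by rewrite /ip trmx0 mulmx0 mxE. Qed.

Lemma ip_suml A I (r : seq I) (P : pred I) (F : I -> 'rV[R]_n) v :
  ip A (\sum_(i <- r | P i) F i) v = \sum_(i <- r | P i) ip A (F i) v.
Proof. by rewrite /ip !mulmx_suml summxE. Qed.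

Lemma ip_sumr A I (r : seq I) (P : pred I) (F : I -> 'rV[R]_n) v :
  ip A v (\sum_(i <- r | P i) F i) = \sum_(i <- r | P i) ip A v (F i).
Proof. by rewrite /ip linear_sum mulmx_sumr summxE. Qed.

Definition ip_simp := (ipDl, ipDr, ipZl, ipZr, ipNl, ipNr, ip0l, ip0r).

Definition posdef A := A^T = A /\ forall u, u != 0 -> 0 < ip A u u.

Lemma posdef_ge0 A u : posdef A -> 0 <= ip A u u.
Proof.
by case=> _ pos; have [->|/pos/ltW//] := eqVneq u 0; rewrite ip0l.
Qed.

Lemma posdef_eq0 A u : posdef A -> ip A u u = 0 -> u = 0.
Proof.
by case=> _ pos u0; apply/eqP; apply/negPn/negP => /pos; rewrite u0 ltxx.
Qed.

Lemma posdef_unitmx A : posdef A -> A \in unitmx.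
Proof.
move=> Apos; rewrite -row_free_unit -kermx_eq0; apply/eqP/row_matrixP => i.
rewrite row0; apply: (posdef_eq0 Apos).
by rewrite /ip -row_mul mulmx_ker row0 mul0mx mxE.
Qed.

Lemma mnorm_sqr A u : posdef A -> mnorm A u ^+ 2 = ip A u u.
Proof. by move=> Apos; rewrite sqr_sqrtr// posdef_ge0. Qed.

Lemma ip_row A k (E : 'M[R]_(k, n)) i j :
  ip A (row i E) (row j E) = (E *m A *m E^T) i j.
Proof.
rewrite /ip -row_mul tr_row colE mulmxA -colE -row_mul.
by rewrite !mxE.
Qed.

(** Gram-Schmidt: as long as fewer than [n] orthonormal vectors are known, some
    nonzero vector is orthogonal to all of them. *)
Lemma orthonormal_rows A k : posdef A -> (k <= n)%N ->
  exists E : 'M[R]_(k, n), E *m A *m E^T = 1%:M.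
Proof.
move=> Apos; elim: k => [|k IHk] kn; first by exists 0; apply/matrixP => -[].
have [E EAE] := IHk (ltnW kn).
have : kermx (A *m E^T) != 0.
  rewrite kermx_eq0 /row_free neq_ltn; apply/orP; left.
  exact: leq_ltn_trans (rank_leq_col _) kn.
move=> /rowV0Pn[w /sub_kermxP wAE w0].
have ww : 0 < ip A w w by case: Apos => _; exact.
pose w1 := (Num.sqrt (ip A w w))^-1 *: w.
have w1w1 : w1 *m A *m w1^T = 1%:M.
  apply/matrixP => i j; rewrite !ord1 [LHS](_ : _ = ip A w1 w1)//.
  rewrite ipZl ipZr mulrA -invfM -expr2 sqr_sqrtr ?ltW//.
  by rewrite mulVf ?mxE ?eqxx// gt_eqF.
have w1E : w1 *m A *m E^T = 0.
  by rewrite -mulmxA -scalemxAl wAE scaler0.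
suff colON : col_mx w1 E *m A *m (col_mx w1 E)^T = 1%:M by exists (col_mx w1 E).
rewrite tr_col_mx mul_col_mx mul_col_row w1w1 w1E EAE.
have -> : E *m A *m w1^T = 0.
  by apply: trmx_inj; rewrite !trmx_mul trmxK Apos.1 mulmxA w1E trmx0.
by rewrite -scalar_mx_block.
Qed.

Lemma exists_orthonormal_frame A : posdef A -> exists e, orthonormal_frame A e.
Proof.
move=> Apos; have [E EAE] := orthonormal_rows Apos (leqnn n).
by exists (fun i => row i E) => i j; rewrite ip_row EAE mxE.
Qed.

Lemma frame_expansion A e u : orthonormal_frame A e ->
  u = \sum_i ip A u (e i) *: e i.
Proof.
move=> eON; pose E := \matrix_i e i.
have EAE : E *m (A *m E^T) = 1%:M.
  apply/matrixP => i j; rewrite mulmxA -ip_row !rowK eON.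
  by rewrite mxE.
rewrite -[LHS]mulmx1 -(mulmx1C EAE) !mulmxA [LHS]mulmx_sum_row.
apply: eq_bigr => i _; rewrite rowK; congr (_ *: _).
by rewrite /ip !mxE; apply: eq_bigr => k _; rewrite !mxE.
Qed.

Lemma parseval A e u v : orthonormal_frame A e ->
  ip A u v = \sum_i ip A u (e i) * ip A (e i) v.
Proof.
move=> eON; rewrite {1}(frame_expansion u eON) ip_suml.
by apply: eq_bigr => i _; rewrite ipZl.
Qed.

End inner_product.

(** Expand one frame in the other: by Parseval the matrix of the change of frame
    is orthogonal. *)
Lemma trace_frame (R : realType) n (A : 'M[R]_n) (b : 'rV[R]_n -> 'rV[R]_n -> R)
    e e' : A^T = A ->
  (forall a u v w, b (a *: u + v) w = a * b u w + b v w) ->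
  (forall a u v w, b w (a *: u + v) = a * b w u + b w v) ->
  orthonormal_frame A e -> orthonormal_frame A e' ->
  \sum_i b (e i) (e i) = \sum_i b (e' i) (e' i).
Proof.
move=> As bl br eON e'ON.
have b0l w : b 0 w = 0 by have := bl 1 0 0 w; rewrite scaler0 addr0; lra.
have b0r w : b w 0 = 0 by have := br 1 0 0 w; rewrite scaler0 addr0; lra.
have bsl (c : 'I_n -> R) (x : 'I_n -> 'rV[R]_n) w :
    b (\sum_i c i *: x i) w = \sum_i c i * b (x i) w.
  elim/big_rec2: _ => [|i ? ? _ <-]; first exact: b0l.
  by rewrite bl.
have bsr (c : 'I_n -> R) (x : 'I_n -> 'rV[R]_n) w :
    b w (\sum_i c i *: x i) = \sum_i c i * b w (x i).
  elim/big_rec2: _ => [|i ? ? _ <-]; first exact: b0r.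
  by rewrite br.
under eq_bigr => i _.
  rewrite (frame_expansion (e i) e'ON) bsl.
  under eq_bigr => j _ do rewrite bsr mulr_sumr.
  over.
rewrite exchange_big/=; apply: eq_bigr => j _.
rewrite exchange_big/= (bigD1 j)//= [X in _ + X]big1 ?addr0 => [|k kj].
  under eq_bigr => i _ do rewrite mulrA (ip_sym (e i) _ As) {2}(ip_sym _ _ As).
  rewrite -mulr_suml.
  under eq_bigr => i _ do rewrite (ip_sym (e' j) (e i) As).
  under eq_bigr => i _ do rewrite {1}(ip_sym (e i) (e' j) As).
  by rewrite -(parseval (e' j) (e' j) eON) e'ON eqxx mul1r.
under eq_bigr => i _ do rewrite mulrA {1}(ip_sym (e i) (e' j) As).
by rewrite -mulr_suml -(parseval (e' j) (e' k) eON) e'ON eq_sym (negPf kj) mul0r.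
Qed.

Lemma bilinear_frame_eq0 (R : realType) n (V : lmodType R) (A : 'M[R]_n)
    (e : 'I_n -> 'rV[R]_n) (b : 'rV[R]_n -> 'rV[R]_n -> V) :
    (forall r u v w, b (r *: u + v) w = r *: b u w + b v w) ->
    (forall r u v w, b w (r *: u + v) = r *: b w u + b w v) ->
    orthonormal_frame A e -> (forall i j, b (e i) (e j) = 0) ->
  forall u v, b u v = 0.
Proof.
move=> bl br eON be0 u v.
have b0l w : b 0 w = 0.
  have /esym/eqP := bl 1 0 0 w.
  by rewrite scale1r scaler0 addr0 -subr_eq0 addrK => /eqP.
have b0r w : b w 0 = 0.
  have /esym/eqP := br 1 0 0 w.
  by rewrite scale1r scaler0 addr0 -subr_eq0 addrK => /eqP.
rewrite (frame_expansion u eON) (frame_expansion v eON).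
elim/big_rec: _ => [|i w _ IH]; first exact: b0l.
rewrite bl IH addr0; elim/big_rec: _ => [|j w' _ IH']; first by rewrite b0r scaler0.
by rewrite br be0 scaler0 add0r.
Qed.

(** Bessel's inequality: [h] minus its orthogonal projection to the span of the
    [a i] has nonnegative square. *)
Lemma bessel (R : realType) n (A : 'M[R]_n) k (a : 'I_k -> 'rV[R]_n) c h :
  posdef A -> 0 < c -> (forall i j, ip A (a i) (a j) = c * (i == j)%:R) ->
  c^-1 * \sum_i ip A h (a i) ^+ 2 <= ip A h h.
Proof.
move=> Apos c0 aON; pose p := \sum_i (c^-1 * ip A h (a i)) *: a i.
have hp : ip A h p = c^-1 * \sum_i ip A h (a i) ^+ 2.
  rewrite ip_sumr mulr_sumr; apply: eq_bigr => i _.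
  by rewrite ipZr expr2 mulrA.
have pp : ip A p p = ip A h p.
  rewrite {1}/p ip_suml hp mulr_sumr; apply: eq_bigr => i _.
  rewrite ipZl ip_sumr (bigD1 i)//= big1 ?addr0 => [|j ji].
    rewrite ipZr aON eqxx mulr1; field; exact: lt0r_neq0.
  by rewrite ipZr aON eq_sym (negPf ji) !mulr0.
have := posdef_ge0 (h - p) Apos.
rewrite !ip_simp (ip_sym p h Apos.1) pp -hp; lra.
Qed.

(** * Real inequalities *)

(** The only relation between [H] and its transpose is that the symmetric part
    is [- mu]; the antisymmetric part splits into orthogonal multiples of [om]
    and [q]. *)
Lemma sum_sqr_lower (R : realFieldType) n (q om H : 'I_n -> 'I_n -> R) mu nu c :
    (forall j k, q j k = - q k j) -> (forall j k, om j k = - om k j) ->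
    (forall j, \sum_k q j k * om j k = 0) -> (forall j, \sum_k om j k ^+ 2 = c) ->
    (forall j k, q j k + 2 * H j k - H k j + mu * (j == k)%:R = nu * om j k) ->
  n%:R * (mu ^+ 2 + nu ^+ 2 * (c / 9)) <= \sum_j \sum_k H j k ^+ 2.
Proof.
move=> qs oms qom om2 Heq.
have HE j k : H j k = - (mu * (j == k)%:R) + 3^-1 * (nu * om j k - q j k).
  have := Heq j k; have := Heq k j; rewrite [k == j]eq_sym (qs k j) (oms k j).
  move: (H j k) (H k j) (q j k) (om j k) (mu * _) => a b p o t; lra.
have diag0 (r : 'I_n -> 'I_n -> R) j : (forall j k, r j k = - r k j) -> r j j = 0.
  by move=> rs; have := rs j j; lra.
have row j : mu ^+ 2 + nu ^+ 2 * (c / 9) <= \sum_k H j k ^+ 2.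
  have rowE : \sum_k H j k ^+ 2 = \sum_k (mu ^+ 2 * (j == k)%:R +
      9^-1 * (nu ^+ 2 * om j k ^+ 2 - 2 * nu * (q j k * om j k) + q j k ^+ 2)).
    apply: eq_bigr => k _; rewrite HE; have [<-|jk] := eqVneq j k.
      by rewrite !mulr1 (diag0 q)// (diag0 om)//; clear; field.
    by rewrite !mulr0; clear; field.
  rewrite rowE big_split/= -mulr_sumr (bigD1 j)//= eqxx big1 ?addr0 => [|k]; last first.
    by rewrite eq_sym => /negPf ->.
  rewrite mulr1 lerD2l -mulr_sumr big_split/= sumrB -!mulr_sumr om2 qom.
  have q2 : 0 <= \sum_k q j k ^+ 2 by apply: sumr_ge0 => k _; exact: sqr_ge0.
  by move: (\sum_k _) q2 => Q Q0; lra.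
rewrite mulr_natl -[X in _ *+ X]card_ord -sumr_const.
by apply: ler_sum => j _; exact: row.
Qed.

Lemma sum_blocks (V : nmodType) (T : Type) n1 n2 (q : T -> T -> V)
    (fr : 'I_(n1 + n2) -> T) (a : 'I_n1 -> T) (b : 'I_n2 -> T) :
    (forall i, fr (lshift n2 i) = a i) -> (forall i, fr (rshift n1 i) = b i) ->
  \sum_i \sum_j q (fr i) (fr j) =
    \sum_i \sum_j q (a i) (a j) + \sum_i \sum_j q (a i) (b j)
    + (\sum_i \sum_j q (b i) (a j) + \sum_i \sum_j q (b i) (b j)).
Proof.
move=> fa fb.
have row t : \sum_j q t (fr j) = \sum_j q t (a j) + \sum_j q t (b j).
  by rewrite big_split_ord/=; congr (_ + _); apply: eq_bigr => j _; rewrite ?fa ?fb.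
rewrite big_split_ord/= -!big_split/=.
by congr (_ + _); apply: eq_bigr => i _; rewrite row ?fa ?fb.
Qed.

Lemma cos_acos_ratio (R : realType) (s t th : R) :
  0 <= s -> 0 < t -> s ^+ 2 <= t ^+ 2 -> th = acos (s / t) ->
  s ^+ 2 = cos th ^+ 2 * t ^+ 2.
Proof.
move=> s0 t0 st ->; rewrite acosK.
  by rewrite -exprMn divfK// gt_eqF.
have st' : s <= t by rewrite -(@ler_pXn2r _ 2)// ?nnegrE// ltW.
rewrite in_itv/= ler_pdivrMr// mul1r st' andbT.
by rewrite (@le_trans _ _ 0)// ?lerN10// divr_ge0// ltW.
Qed.

(** * Calculus in coordinates *)

Lemma dist_le_sum_half (R : realFieldType) (a b p e : R) :
  `|p - a| < e / 2 -> `|p - b| < e / 2 -> `|a - b| <= e.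
Proof.
move=> pa pb; rewrite (le_trans (ler_distD p _ _))// [e]splitr lerD ?(ltW pb)//.
by rewrite distrC ltW.
Qed.

Section line_derivatives.
Context (R : realType) (V : normedModType R).
Implicit Types (f : V -> R) (x u v y : V).

Lemma is_derive_line f u y t : derivable f (t *: u + y) u ->
  is_derive t 1 (fun s : R => f (s *: u + y)) ('D_u f (t *: u + y)).
Proof.
move=> df.
have quotE : (fun h : R => h^-1 *: (f ((h *: 1 + t) *: u + y) - f (t *: u + y))) =
    (fun h : R => h^-1 *: (f (h *: u + (t *: u + y)) - f (t *: u + y))).
  by apply/funext => h; rewrite scalerDl addrA [h *: 1]mulr1.
apply: DeriveDef.
  by rewrite /derivable quotE.
by rewrite /derive quotE.
Qed.

Lemma mvt_line f u y s : 0 < s ->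
    (forall t, 0 <= t <= s -> derivable f (t *: u + y) u) ->
  exists2 t, 0 <= t <= s & f (s *: u + y) - f y = s * 'D_u f (t *: u + y).
Proof.
move=> s0 df.
have dline t : 0 <= t <= s -> is_derive t 1 (fun s : R => f (s *: u + y))
    ('D_u f (t *: u + y)) by move=> /df; exact: is_derive_line.
have [t|t st|t st e] := @MVT _ (fun s : R => f (s *: u + y))
    (fun t => 'D_u f (t *: u + y)) 0 s s0; last first.
- by exists t; [move: st; rewrite in_itv/= => /andP[/ltW-> /ltW->]|
    move: e; rewrite scale0r add0r subr0 mulrC].
- apply: derivable_within_continuous st => r.
  by rewrite in_itv/= => rs; have [] := dline r rs.
by rewrite in_itv/= => /andP[/ltW t0 /ltW ts]; apply: dline; rewrite t0.
Qed.

(** The mean value theorem twice: in the direction [u] for the increment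
    [f (s v + y) - f y], then in the direction [v] for ['D_u f]. *)
Lemma second_difference f u v x s : 0 < s ->
    (forall a b : R, 0 <= a <= s -> 0 <= b <= s ->
      derivable f (a *: u + (b *: v + x)) u /\
      derivable ('D_u f) (a *: u + (b *: v + x)) v) ->
  exists a b, [/\ 0 <= a <= s, 0 <= b <= s &
    f (s *: u + (s *: v + x)) - f (s *: u + x) - f (s *: v + x) + f x =
    s * s * 'D_v ('D_u f) (a *: u + (b *: v + x))].
Proof.
move=> s0 df; have s00 : 0 <= (0 : R) <= s by rewrite lexx ltW.
have ss : 0 <= s <= s by rewrite lexx ltW.
have dfs (a : R) : 0 <= a <= s -> derivable f (a *: u + (s *: v + x)) u.
  by move=> as_; have [d _] := df a s as_ ss.
have df0 (a : R) : 0 <= a <= s -> derivable f (a *: u + x) u.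
  by move=> /df/(_ s00)[]; rewrite scale0r add0r.
pose g y := f (s *: v + y) - f y.
have dshift (a : R) : 0 <= a <= s -> is_derive (a *: u + x) u (fun y => f (s *: v + y))
    ('D_u f (a *: u + (s *: v + x))).
  move=> /dfs d.
  have quotE : (fun h : R => h^-1 *: (f (s *: v + (h *: u + (a *: u + x))) -
        f (s *: v + (a *: u + x)))) =
      (fun h : R => h^-1 *: (f (h *: u + (a *: u + (s *: v + x))) -
        f (a *: u + (s *: v + x)))).
    apply/funext => h; rewrite [s *: v + (a *: u + x)]addrCA.
    by rewrite [s *: v + (h *: u + _)]addrCA [s *: v + (a *: u + x)]addrCA.
  apply: DeriveDef.
    by rewrite /derivable quotE.
  by rewrite /derive quotE.
have dg (a : R) : 0 <= a <= s -> is_derive (a *: u + x) u g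
    ('D_u f (a *: u + (s *: v + x)) - 'D_u f (a *: u + x)).
  move=> as_; have h1 := dshift a as_; have h2 := derivableP (df0 a as_).
  exact: is_deriveB.
have dgd (a : R) : 0 <= a <= s -> derivable g (a *: u + x) u by case/dg.
have [a as_ ga] := mvt_line s0 dgd.
have [_ dgE] := dg a as_; rewrite {}dgE addrCA in ga.
have ddf (b : R) : 0 <= b <= s -> derivable ('D_u f) (b *: v + (a *: u + x)) v.
  by rewrite addrCA => /(df a _ as_)[].
have [b bs hb] := mvt_line s0 ddf.
exists a, b; split; [exact: as_|exact: bs|].
rewrite [a *: u + _]addrCA -mulrA -hb -ga /g [s *: u + (_ + _)]addrCA.
clear; ring.
Qed.

(** Schwarz's theorem: both mixed derivatives are limits of second differences
    over the same shrinking parallelograms. *)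
Lemma schwarz f u v x :
    (\forall y \near x, [/\ derivable f y u, derivable f y v,
      derivable ('D_u f) y v & derivable ('D_v f) y u]) ->
    {for x, continuous ('D_v ('D_u f))} -> {for x, continuous ('D_u ('D_v f))} ->
  'D_v ('D_u f) x = 'D_u ('D_v f) x.
Proof.
move=> df cvu cuv; apply/eqP; rewrite -subr_eq0 -normr_le0.
apply/ler_addgt0Pl => e e0; rewrite addr0.
have e2 : 0 < e / 2 by rewrite divr_gt0.
have cvu' : \forall y \near x, `|'D_v ('D_u f) y - 'D_v ('D_u f) x| < e / 2.
  exact: (@cvgr_distC_lt R R V (nbhs x) _ _ _ cvu _ e2).
have cuv' : \forall y \near x, `|'D_u ('D_v f) y - 'D_u ('D_v f) x| < e / 2.
  exact: (@cvgr_distC_lt R R V (nbhs x) _ _ _ cuv _ e2).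
pose Fx : Filter (nbhs x) := nbhs_filter x.
have := @filterI _ _ Fx _ _ df (@filterI _ _ Fx _ _ cvu' cuv').
move=> /nbhs_ballP[r r0 xr].
(* a parallelogram of this side lies in the ball of radius [r] *)
pose s := r / 2 / (`|u| + `|v| + 1).
have n0 : 0 < `|u| + `|v| + 1 by rewrite ltr_wpDl// addr_ge0.
have s0 : 0 < s by rewrite !divr_gt0.
have near_ball (a b : R) : 0 <= a <= s -> 0 <= b <= s ->
    ball x r (a *: u + (b *: v + x)).
  move=> /andP[a0 as_] /andP[b0 bs]; rewrite -ball_normE/= addrA opprD addrCA.
  rewrite subrr addr0.
  rewrite normrN (le_lt_trans (ler_normD _ _))// !normrZ !ger0_norm//.
  apply: (@le_lt_trans _ _ (s * (`|u| + `|v|))).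
    by rewrite mulrDr lerD// ler_wpM2r.
  apply: (@le_lt_trans _ _ (r / 2)); last by rewrite ltr_pdivrMr// ltr_pMr// ltr1n.
  by rewrite /s mulrAC ler_pdivrMr// ler_pM2l ?divr_gt0// lerDl.
have [|a [b [as_ bs eab]]] := @second_difference f u v x s s0.
  move=> a b as_ bs; have [[du _ duv _] _] := xr _ (near_ball a b as_ bs).
  exact: conj du duv.
have [|b' [a' [bs' as' eab']]] := @second_difference f v u x s s0.
  move=> a' b' as' bs'; rewrite addrCA.
  by have [[_ dv _ dvu] _] := xr _ (near_ball b' a' bs' as'); exact: conj dv dvu.
have [_ [h1 _]] := xr _ (near_ball a b as_ bs).
have [_ [_]] := xr _ (near_ball a' b' as' bs'); rewrite addrCA => h2.
have same : 'D_v ('D_u f) (a *: u + (b *: v + x)) =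
    'D_u ('D_v f) (b' *: v + (a' *: u + x)).
  apply: (@mulfI _ (s * s)); first by rewrite mulf_neq0// gt_eqF.
  have swap : s *: v + (s *: u + x) = s *: u + (s *: v + x) by rewrite addrCA.
  rewrite swap in eab'; rewrite -[LHS]eab -[RHS]eab'; clear; ring.
rewrite same in h1.
exact: dist_le_sum_half h1 h2.
Qed.

End line_derivatives.

Section matrix_valued.
Context (R : realType) (V : normedModType R).

Lemma differentiable_mxP m n (M : V -> 'M[R]_(m, n)) x :
  (forall i j, differentiable (fun y => M y i j) x) -> differentiable M x.
Proof.
move=> dM; rewrite (_ : M = \sum_(i < m) \sum_(j < n)
    (fun y => M y i j *: (delta_mx i j : 'M[R]_(m, n)))); last first.
  apply/funext => y; rewrite [LHS]matrix_sum_delta fct_sumE.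
  by apply: eq_bigr => i _; rewrite fct_sumE.
apply: differentiable_sum => i; apply: differentiable_sum => j.
exact: differentiableZl.
Qed.

Lemma differentiable_entry m n (M : V -> 'M[R]_(m, n)) x i j :
  differentiable M x -> differentiable (fun y => M y i j) x.
Proof.
move=> dM.
exact: (differentiable_comp dM (differentiable_coord (M x) i j)).
Qed.

Lemma is_derive_mulmx m n p (M : V -> 'M[R]_(m, n)) (N : V -> 'M[R]_(n, p)) x u :
  derivable M x u -> derivable N x u ->
  is_derive x u (fun y => M y *m N y) ('D_u M x *m N x + M x *m 'D_u N x).
Proof.
move=> dM dN.
have dMij i j := derivableP ((derivable_mxP M x u).1 dM i j).
have dNij i j := derivableP ((derivable_mxP N x u).1 dN i j).
have dMN i k : is_derive x u (fun y => (M y *m N y) i k)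
    (('D_u M x *m N x + M x *m 'D_u N x) i k).
  rewrite (derive_mx dM) (derive_mx dN) !mxE -big_split/=.
  rewrite [X in is_derive _ _ X _](_ : _ =
      \sum_j ((fun y => M y i j) * (fun y => N y j k))); last first.
    by apply/funext => y; rewrite mxE fct_sumE.
  apply: is_derive_sum => j.
  apply: (is_derive_eq (is_deriveM (dMij i j) (dNij j k))).
  by rewrite !mxE addrC; congr (_ + _); exact: mulrC.
have d : derivable (fun y => M y *m N y) x u.
  by apply/derivable_mxP => i k; have [] := dMN i k.
apply: DeriveDef => //; rewrite (derive_mx d).
by apply/matrixP => i k; rewrite mxE; have [_ ->] := dMN i k.
Qed.

Lemma derive_mulmx_cst m n p (M : 'M[R]_(m, n)) (N : V -> 'M[R]_(n, p)) x u :
  derivable N x u -> 'D_u (fun y => M *m N y) x = M *m 'D_u N x.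
Proof.
move=> dN; have [_ ->] := is_derive_mulmx (derivable_cst M x u) dN.
by rewrite derive_cst mul0mx add0r.
Qed.

Lemma differentiable_mulmx m n p (M : V -> 'M[R]_(m, n)) (N : V -> 'M[R]_(n, p)) x :
  differentiable M x -> differentiable N x ->
  differentiable (fun y => M y *m N y) x.
Proof.
move=> dM dN; apply: differentiable_mxP => i k.
rewrite [X in differentiable X _](_ : _ =
    \sum_j ((fun y => M y i j) * (fun y => N y j k))); last first.
  by apply/funext => y; rewrite mxE fct_sumE.
apply: differentiable_sum => j.
by apply: differentiableM; exact: differentiable_entry.
Qed.

Lemma differentiable_trmx m n (M : V -> 'M[R]_(m, n)) x :
  differentiable M x -> differentiable (fun y => (M y)^T) x.
Proof.
move=> dM; apply: differentiable_mxP => i k.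
rewrite [X in differentiable X _](_ : _ = fun y => M y k i); last first.
  by apply/funext => y; rewrite mxE.
exact: differentiable_entry.
Qed.

Lemma near_eq_differentiable (W : normedModType R) (f g : V -> W) x :
  (\forall y \near x, f y = g y) -> differentiable f x -> differentiable g x.
Proof.
move=> fg df.
suff dk : differentiable (g - f) x.
  by rewrite -(subrK f g); exact: differentiableD.
have k0 : \forall y \near x, (g - f) y = 0.
  by apply: filterS fg => y fgy; rewrite !fctE fgy subrr.
have gfx : (g - f) x = 0 by exact: nbhs_singleton k0.
pose z : {linear V -> W} := \0.
suff kz : 'd (g - f) x = z :> (V -> W) /\ differentiable (g - f) x by case: kz.
have cz : continuous z by exact: cst_continuous.
suff e : (g - f) \o shift x = cst ((g - f) x) + z +o_ 0 id.
  have dz := diff_unique cz e; split => //.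
  by apply/diff_locallyP; rewrite dz; split.
apply/eqaddoP => _ /posnumP[e]; near=> h.
have -> : ((g - f) \o shift x - (cst ((g - f) x) + z)) h =
    (g - f) (h + x) - ((g - f) x + 0) by [].
have -> : (g - f) (h + x) = 0.
  near: h; move: k0; rewrite (near_shift (0 : V)) /=.
  by apply: filterS => h; rewrite subr0.
by rewrite gfx addr0 subr0 normr0 mulr_ge0.
Unshelve. all: by end_near. Qed.

End matrix_valued.

Section coordinate_derivatives.
Context (R : realType).

Lemma derive_lin n (W : normedModType R) (f : 'rV[R]_n -> W) x u :
  differentiable f x -> 'D_u f x = \sum_i u 0 i *: 'D_(ebase R i) f x.
Proof.
move=> df; rewrite deriveE// {1}[u]row_sum_delta linear_sum.
by apply: eq_bigr => i _; rewrite linearZ/= deriveE.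
Qed.

Lemma deriveP n (W : normedModType R) (f : 'rV[R]_n -> W) x a u v :
  differentiable f x -> 'D_(a *: u + v) f x = a *: 'D_u f x + 'D_v f x.
Proof. by move=> df; rewrite !deriveE// linearP. Qed.

Lemma derive_lineE (V W : normedModType R) (f : V -> W) x v :
  'D_v f x = 'D_1 (fun t : R => f (t *: v + x)) 0.
Proof.
rewrite /derive; set f1 := fun h => _; set f2 := fun h => _.
suff -> : f1 = f2 by [].
by apply/funext => h; rewrite /f1 /f2 /= scale0r add0r addr0 [h *: 1]mulr1.
Qed.

(** A directional derivative only sees the line, on which two functions may
    agree without agreeing near the point. *)
Lemma near_line_derive (V W : normedModType R) (f k : V -> W) x v :
  (\forall t \near (0 : R), f (t *: v + x) = k (t *: v + x)) ->
  'D_v f x = 'D_v k x.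
Proof.
move=> fk; rewrite (derive_lineE f) (derive_lineE k).
exact: near_eq_derive.
Qed.

Lemma derive_ln (V : normedModType R) (w : V -> R) x v :
  0 < w x -> differentiable w x ->
  differentiable (fun y => ln (w y)) x /\
  'D_v (fun y => ln (w y)) x = (w x)^-1 * 'D_v w x.
Proof.
move=> w0 dw; have dln := is_derive1_ln w0.
have dlnw : differentiable (@ln R) (w x).
  by apply/derivable1_diffP; case: dln.
split; first exact: (differentiable_comp dw dlnw).
rewrite (derive_lineE (fun y => ln (w y))).
have dl : is_derive (0 : R) 1 (fun t : R => w (t *: v + x)) ('D_v w x).
  rewrite (derive_lineE w); apply: derivableP.
  exact: ((derivable1P w x v).1 (diff_derivable dw)).
have wl : w (0 *: v + x) = w x by rewrite scale0r add0r.
rewrite -wl in dln.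
have [_ ->] := is_derive1_comp (g := fun t : R => w (t *: v + x)) dln dl.
by rewrite wl.
Qed.

Lemma derive_chain n n' (W : normedModType R) (F : 'rV[R]_n -> 'rV[R]_n')
    (g : 'rV[R]_n' -> W) x u :
  differentiable F x -> differentiable g (F x) ->
  'D_u (fun y => g (F y)) x = 'D_(u *m 'J F x) g (F x).
Proof.
move=> dF dg; rewrite -deriveEjacobian// !deriveE//; last first.
  exact: differentiable_comp.
by rewrite (@diff_comp _ _ _ _ F g).
Qed.

Lemma differentiable_along n n' (W : normedModType R)
    (F : 'rV[R]_n -> 'rV[R]_n') (g : 'rV[R]_n' -> W) x :
  differentiable F x -> differentiable g (F x) ->
  differentiable (fun y => g (F y)) x.
Proof. by move=> dF dg; exact: (differentiable_comp dF dg). Qed.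

Lemma derive_lsubmx n1 n2 (W : normedModType R) (k : 'rV[R]_n1 -> W)
    (x v : 'rV[R]_(n1 + n2)) :
  'D_v (fun y => k (lsubmx y)) x = 'D_(lsubmx v) k (lsubmx x).
Proof.
rewrite /derive; set f1 := fun h => _; set f2 := fun h => _.
suff -> : f1 = f2 by [].
apply/funext => h; rewrite /f1 /f2 /=.
have -> : lsubmx (h *: v + x) = h *: lsubmx v + lsubmx x.
  by apply/rowP => i; rewrite !mxE.
by [].
Qed.

Lemma derive_affine k n (W : normedModType R) (f : 'rV[R]_n -> W)
    (A : 'M[R]_(k, n)) b z u :
  'D_u (fun w => f (w *m A + b)) z = 'D_(u *m A) f (z *m A + b).
Proof.
rewrite /derive; set f1 := fun h => _; set f2 := fun h => _.
suff -> : f1 = f2 by [].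
by apply/funext => h; rewrite /f1 /f2 /= mulmxDl -scalemxAl addrA.
Qed.

(** The function is constant along [v]. *)
Lemma is_derive_rsubmx0 n1 n2 (k : 'rV[R]_n2 -> R)
    (x v : 'rV[R]_(n1 + n2)) : rsubmx v = 0 ->
  is_derive x v (fun y => k (rsubmx y)) 0.
Proof.
move=> v0; have quotE :
    (fun h : R => h^-1 *: (k (rsubmx (h *: v + x)) - k (rsubmx x))) = cst 0.
  apply/funext => h; have -> : rsubmx (h *: v + x) = h *: rsubmx v + rsubmx x.
    by apply/rowP => i; rewrite !mxE.
  by rewrite v0 scaler0 add0r subrr scaler0.
apply: DeriveDef.
  by rewrite /derivable quotE; exact: is_cvg_cst.
by rewrite /derive quotE lim_cst.
Qed.

End coordinate_derivatives.

(** * Regularity of smooth maps *)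

Section smooth_maps.
Context (R : realType) (n : nat) (U : set 'rV[R]_n).

Lemma smooth_on_cst (c : R) : smooth_on U (fun=> c).
Proof.
move=> s x _; suff [c' ->] : exists c', iter_partial s (fun=> c) = cst c'.
  exact: differentiable_cst.
elim: s => [|i s [c' IHs]] /=; first by exists c.
by exists 0; apply/funext => y; rewrite -/(iter_partial s _) IHs derive_cst.
Qed.

Lemma smooth_mx_on_cst a b (A : 'M[R]_(a, b)) : smooth_mx_on U (fun=> A).
Proof. by move=> i j; exact: smooth_on_cst. Qed.

Lemma smooth_differentiable f x : smooth_on U f -> U x -> differentiable f x.
Proof. by move=> sf; exact: (sf [::]). Qed.

Lemma smooth_mx_differentiable a b (f : 'rV[R]_n -> 'M[R]_(a, b)) x :
  smooth_mx_on U f -> U x -> differentiable f x.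
Proof.
move=> sf Ux; apply: differentiable_mxP => i j.
exact: (smooth_differentiable (sf i j) Ux).
Qed.

Lemma smooth_schwarz f x i j : open U -> smooth_on U f -> U x ->
  'D_(ebase R i) ('D_(ebase R j) f) x = 'D_(ebase R j) ('D_(ebase R i) f) x.
Proof.
move=> Uo sf Ux; have Unear : \forall y \near x, U y by exact: open_nbhs_nbhs.
apply: schwarz.
- apply: filterS Unear => y Uy; split; apply: diff_derivable.
  + exact: (sf [::] y Uy).
  + exact: (sf [::] y Uy).
  + exact: (sf [:: j] y Uy).
  + exact: (sf [:: i] y Uy).
- exact: (differentiable_continuous (sf [:: i; j] x Ux)).
- exact: (differentiable_continuous (sf [:: j; i] x Ux)).
Qed.

End smooth_maps.

(** What the second fundamental form needs to know about a parametrization. *)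
Record regular_at (R : realType) n n' (F : 'rV[R]_n -> 'rV[R]_n')
    (x : 'rV[R]_n) : Prop := {
  regular_near : \forall y \near x, differentiable F y;
  regular_jacobian : differentiable (jacobian F) x;
  regular_hessian : forall u v,
    v *m 'D_u (jacobian F) x = u *m 'D_v (jacobian F) x }.

Lemma jacobianE (R : realType) n n' (F : 'rV[R]_n -> 'rV[R]_n') x i j :
  differentiable F x -> 'J F x i j = 'D_(ebase R i) (fun y => F y 0 j) x.
Proof.
move=> dF; have := deriveEjacobian (ebase R i) dF.
rewrite /ebase -rowE (derive_mx (diff_derivable dF)) => /rowP/(_ j).
by rewrite !mxE.
Qed.

Lemma smooth_regular (R : realType) n n' (U : set 'rV[R]_n)
    (F : 'rV[R]_n -> 'rV[R]_n') x :
  open U -> smooth_mx_on U F -> U x -> regular_at F x.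
Proof.
move=> Uo sF Ux; have Unear : \forall y \near x, U y by exact: open_nbhs_nbhs.
have dF : \forall y \near x, differentiable F y.
  by apply: filterS Unear => y; exact: smooth_mx_differentiable.
have JE i j : \forall y \near x,
    'D_(ebase R i) (fun z => F z 0 j) y = 'J F y i j.
  by apply: filterS dF => y dFy; rewrite jacobianE.
have dJ : differentiable (jacobian F) x.
  apply: differentiable_mxP => i j; apply: near_eq_differentiable (JE i j) _.
  exact: (sF 0 j [:: i] x Ux).
split; [exact: dF|exact: dJ|move=> u v; apply/rowP => k].
pose H l i := 'D_(ebase R l) ('D_(ebase R i) (fun z => F z 0 k)) x.
have HC l i : H l i = H i l by exact: smooth_schwarz Uo (sF 0 k) Ux.
have expand (a b : 'rV[R]_n) : (b *m 'D_a (jacobian F) x) 0 k =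
    \sum_i \sum_l a 0 l * b 0 i * H l i.
  rewrite mxE; apply: eq_bigr => i _.
  rewrite (derive_lin _ dJ) summxE mulr_sumr; apply: eq_bigr => l _.
  rewrite (derive_mx (diff_derivable dJ)) !mxE mulrCA mulrA.
  by congr (_ * _); apply: near_eq_derive; apply: filterS (JE i k).
apply: (etrans (expand u v)); apply: (etrans _ (esym (expand v u))).
move: H HC {expand} => H HC; rewrite exchange_big/=.
by apply: eq_bigr => i _; apply: eq_bigr => l _; rewrite [u 0 i * _]mulrC HC.
Qed.

(** * The second fundamental form of an immersion *)

Section christoffel_symbols.
Context (R : realType) (n : nat) (G : 'rV[R]_n -> 'M[R]_n) (x : 'rV[R]_n).
Context (dG : differentiable G x).

Lemma christoffel_row u v : christoffel G x u v =
  (\row_k (2^-1 * (ip ('D_u G x) v (ebase R k) + ip ('D_v G x) u (ebase R k)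
                   - ip ('D_(ebase R k) G x) u v))) *m invmx (G x).
Proof.
have D z a b : 'D_z (fun y => ip (G y) a b) x = ip ('D_z G x) a b.
  exact: derive_ip_cst (diff_derivable dG).
congr (_ *m _); apply/rowP => k; rewrite [LHS]mxE [RHS]mxE.
by rewrite (D u) (D v) (D (ebase R k)).
Qed.

Lemma christoffel_linear a u v w :
  christoffel G x u (a *: v + w) = a *: christoffel G x u v + christoffel G x u w.
Proof.
rewrite !christoffel_row (deriveP _ _ _ dG) scalemxAl -mulmxDl; congr (_ *m _).
move: ('D_u G x) ('D_v G x) ('D_w G x) (fun k => 'D_(ebase R k) G x) => A B C E.
apply/rowP => k; rewrite !mxE !ip_simp.
have -> : ip (a *: B + C) u (ebase R k) =
    a * ip B u (ebase R k) + ip C u (ebase R k).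
  by rewrite /ip mulmxDr mulmxDl -scalemxAr -scalemxAl !mxE.
by clear; ring.
Qed.

Lemma christoffel_sym u v : (\forall y \near x, (G y)^T = G y) ->
  christoffel G x u v = christoffel G x v u.
Proof.
move=> Gs; rewrite /christoffel; congr (_ *m _); apply/rowP => k; rewrite !mxE.
rewrite ['D_u _ x + _]addrC; congr (_ * (_ - _)).
by apply: near_eq_derive; apply: filterS Gs => y; exact: ip_sym.
Qed.

End christoffel_symbols.

Section derivative_of_ip.
Context (R : realType) (V : normedModType R) (n : nat).

Lemma derive_trmx a b (M : V -> 'M[R]_(a, b)) x u : derivable M x u ->
  derivable (fun y => (M y)^T) x u /\
  'D_u (fun y => (M y)^T) x = ('D_u M x)^T.
Proof.
move=> dM; have trE i j : (fun y => (M y)^T i j) = (fun y => M y j i).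
  by apply/funext => y; rewrite mxE.
have dMt : derivable (fun y => (M y)^T) x u.
  apply/derivable_mxP => i j; rewrite trE.
  exact: (derivable_mxP M x u).1.
split; first exact: dMt.
rewrite (derive_mx dMt) (derive_mx dM); apply/matrixP => i j; rewrite !mxE.
by rewrite trE.
Qed.

Lemma derivable_ip (A : V -> 'M[R]_n) (Y Z : V -> 'rV[R]_n) x u :
    derivable A x u -> derivable Y x u -> derivable Z x u ->
  derivable (fun y => ip (A y) (Y y) (Z y)) x u.
Proof.
move=> dA dY /derive_trmx[dZt _]; have [dYA _] := is_derive_mulmx dY dA.
have [dm _] := is_derive_mulmx dYA dZt.
exact: ((derivable_mxP _ x u).1 dm 0 0).
Qed.

(** The product rule for fields along a map, whose base need not have the
    dimension of the ambient space. *)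
Lemma derive_ip_field (A : V -> 'M[R]_n) (Y Z : V -> 'rV[R]_n) x u :
    derivable A x u -> derivable Y x u -> derivable Z x u ->
  'D_u (fun y => ip (A y) (Y y) (Z y)) x =
    ip ('D_u A x) (Y x) (Z x) + ip (A x) ('D_u Y x) (Z x)
    + ip (A x) (Y x) ('D_u Z x).
Proof.
move=> dA dY /derive_trmx[dZt Zt].
have [dYA YA] := is_derive_mulmx dY dA.
have [dYAZ YAZ] := is_derive_mulmx dYA dZt.
have entry : 'D_u (fun y => ip (A y) (Y y) (Z y)) x =
    ('D_u (fun y => Y y *m A y *m (Z y)^T) x) 0 0.
  by rewrite (derive_mx dYAZ) mxE.
rewrite entry YAZ YA Zt /ip mulmxDl !mxE.
by rewrite [X in X + _ = _]addrC.
Qed.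

End derivative_of_ip.

Section along_a_map.
Context (R : realType) (n n' : nat) (G : 'rV[R]_n' -> 'M[R]_n').
Context (F : 'rV[R]_n -> 'rV[R]_n') (x : 'rV[R]_n).
Context (dF : differentiable F x).
Context (dG : differentiable G (F x)).
Context (Gsym : \forall y \near F x, (G y)^T = G y).
Context (Gpos : posdef (G (F x))).

Lemma levi_civita_along_metric (V W : 'rV[R]_n -> 'rV[R]_n') u :
    derivable V x u -> derivable W x u ->
  'D_u (fun y => ip (G (F y)) (V y) (W y)) x =
    ip (G (F x)) (levi_civita_along G F u V x) (W x)
    + ip (G (F x)) (V x) (levi_civita_along G F u W x).
Proof.
move=> dV dW; have Gunit := posdef_unitmx Gpos.
have dGF : derivable (fun y => G (F y)) x u.
  exact: diff_derivable (differentiable_along dF dG).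
rewrite (derive_ip_field dGF dV dW) (derive_chain _ dF dG).
have := @levi_civita_metric _ _ G (cst (V x)) (cst (W x)) (F x) (u *m 'J F x)
  Gsym Gunit dG (derivable_cst _ _ _) (derivable_cst _ _ _).
rewrite derive_ip_cst; last exact: diff_derivable.
move=> ->; rewrite /levi_civita /levi_civita_along !derive_cst !add0r /=.
by rewrite ipDl ipDr; clear; ring.
Qed.

End along_a_map.

Section immersed.
Context (R : realType) (n n' : nat) (G : 'rV[R]_n' -> 'M[R]_n').
Context (F : 'rV[R]_n -> 'rV[R]_n') (x : 'rV[R]_n).
Context (Freg : regular_at F x).
Context (dG : differentiable G (F x)).
Context (Gsym : \forall y \near F x, (G y)^T = G y).
Context (Gpos : posdef (G (F x))).
Context (Finj : injective (fun u : 'rV[R]_n => u *m 'J F x)).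

Let dF : differentiable F x. Proof. exact: nbhs_singleton (regular_near Freg). Qed.
Let dJ (u : 'rV[R]_n) : derivable (jacobian F) x u.
Proof. exact: diff_derivable (regular_jacobian Freg). Qed.

(** The second fundamental form is the normal part of this vector, the induced
    connection its tangential part. *)
Definition coord_deriv (G : 'rV[R]_n' -> 'M[R]_n') (F : 'rV[R]_n -> 'rV[R]_n')
    (x u v : 'rV[R]_n) : 'rV[R]_n' :=
  levi_civita_along G F u (fun y => v *m 'J F y) x.

Local Notation g := (ip (G (F x))).
Local Notation L := (coord_deriv G F x).
Local Notation h := (second_ff G F x).
Local Notation gI := (induced_metric G F).

Lemma derivable_coord_field (u v : 'rV[R]_n) : derivable (fun y => v *m 'J F y) x u.
Proof. by have [] := is_derive_mulmx (derivable_cst v x u) (@dJ u). Qed.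

Lemma coord_derivE (u v : 'rV[R]_n) :
  L u v = v *m 'D_u (jacobian F) x + christoffel G (F x) (u *m 'J F x) (v *m 'J F x).
Proof. by rewrite /coord_deriv /levi_civita_along (derive_mulmx_cst v (@dJ u)). Qed.

Lemma coord_deriv_sym u v : L u v = L v u.
Proof.
by rewrite !coord_derivE (christoffel_sym _ _ Gsym) (regular_hessian Freg).
Qed.

Lemma coord_deriv_linear a u v w : L u (a *: v + w) = a *: L u v + L u w.
Proof.
rewrite !coord_derivE mulmxDl -scalemxAl (mulmxDl (a *: v)) -scalemxAl.
by rewrite (christoffel_linear dG) scalerDr addrACA.
Qed.

Lemma ip_induced y u v : ip (gI y) u v = ip (G (F y)) (u *m 'J F y) (v *m 'J F y).
Proof. by rewrite /ip /induced_metric trmx_mul !mulmxA. Qed.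

Lemma induced_posdef : posdef (gI x).
Proof.
split; first by rewrite /induced_metric !trmx_mul trmxK Gpos.1 mulmxA.
move=> u u0; rewrite ip_induced; apply: Gpos.2.
apply: contra_neq u0 => uJ0; apply: Finj.
by rewrite uJ0 mul0mx.
Qed.

Lemma induced_differentiable : differentiable gI x.
Proof.
have dJF := regular_jacobian Freg.
apply: differentiable_mulmx; last exact: differentiable_trmx.
by apply: differentiable_mulmx => //; exact: differentiable_along.
Qed.

Lemma derive_induced u v w : 'D_u (fun y => ip (gI y) v w) x =
  g (L u v) (w *m 'J F x) + g (v *m 'J F x) (L u w).
Proof.
under eq_fun do rewrite ip_induced.
rewrite (levi_civita_along_metric dF dG Gsym Gpos)//; exact: derivable_coord_field.
Qed.

(** Koszul's argument: the tangential part of the ambient derivative is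
    determined by the induced metric. *)
Lemma koszul u v w : g (L u v) (w *m 'J F x) =
  2^-1 * ('D_u (fun y => ip (gI y) v w) x + 'D_v (fun y => ip (gI y) u w) x
          - 'D_w (fun y => ip (gI y) u v) x).
Proof.
pose K a b c := g (L a b) (c *m 'J F x).
have D a b c : 'D_a (fun y => ip (gI y) b c) x = K a b c + K a c b.
  by rewrite derive_induced (ip_sym (b *m 'J F x) (L a c) Gpos.1).
have KC a b c : K a b c = K b a c by rewrite /K coord_deriv_sym.
rewrite -/(K u v w) (D u) (D v) (D w) (KC v u) (KC w u) (KC w v).
by move: (K u v w) (K u w v) (K v w u) => a b c; lra.
Qed.

Lemma second_ffE u v : h u v = L u v - christoffel gI x u v *m 'J F x.
Proof. by rewrite /second_ff /levi_civita derive_cst add0r. Qed.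

Lemma second_ff_normal u v w : g (h u v) (w *m 'J F x) = 0.
Proof.
have gIu : gI x \in unitmx by exact: posdef_unitmx induced_posdef.
have gamma : g (christoffel gI x u v *m 'J F x) (w *m 'J F x) = g (L u v) (w *m 'J F x).
  rewrite koszul -ip_induced.
  exact: (christoffelP u v w induced_differentiable gIu).
by rewrite second_ffE ipDl ipNl gamma subrr.
Qed.

Lemma induced_sym_near : \forall y \near x, (gI y)^T = gI y.
Proof.
have Gs : \forall y \near x, (G (F y))^T = G (F y).
  have cF : F @ x --> F x by exact: differentiable_continuous.
  exact: cF _ Gsym.
apply: filterS Gs => y Gy.
by rewrite /induced_metric !trmx_mul trmxK Gy mulmxA.
Qed.

Lemma second_ff_sym u v : h u v = h v u.
Proof.
rewrite !second_ffE coord_deriv_sym (christoffel_sym _ _ induced_sym_near)//.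
Qed.

Lemma second_ff_linear a u v w : h u (a *: v + w) = a *: h u v + h u w.
Proof.
rewrite !second_ffE coord_deriv_linear (christoffel_linear induced_differentiable).
rewrite mulmxDl -scalemxAl scalerBr.
move: (L u v) (L u w) (_ *m _) (_ *m _) => a1 a2 b1 b2.
by rewrite opprD addrACA.
Qed.

Lemma second_ff_linearl a u v w : h (a *: u + v) w = a *: h u w + h v w.
Proof. by rewrite !(second_ff_sym _ w) second_ff_linear. Qed.

Lemma tangent_normal_eq0 u : (forall w, g (u *m 'J F x) (w *m 'J F x) = 0) -> u = 0.
Proof.
move=> u0; apply: (posdef_eq0 induced_posdef).
by rewrite ip_induced u0.
Qed.

(** [h] is bilinear: change the frame in one argument at a time. *)
Lemma second_ff_norm2_frame e e' :
    orthonormal_frame (gI x) e -> orthonormal_frame (gI x) e' ->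
  second_ff_norm2 G F x e = second_ff_norm2 G F x e'.
Proof.
move=> eON e'ON; rewrite /second_ff_norm2.
transitivity (\sum_i \sum_j g (h (e i) (e' j)) (h (e i) (e' j))).
  apply: eq_bigr => i _.
  apply: (trace_frame (b := fun u v => g (h (e i) u) (h (e i) v)) induced_posdef.1)
    eON e'ON => a u v w.
    by rewrite second_ff_linear ipDl ipZl.
  by rewrite second_ff_linear ipDr ipZr.
apply: (etrans (exchange_big _ _ _ _ _ _)).
apply: (etrans _ (exchange_big _ _ _ _ _ _)); apply: eq_bigr => j _.
apply: (trace_frame (b := fun u v => g (h u (e' j)) (h v (e' j))) induced_posdef.1)
  eON e'ON => a u v w.
  by rewrite second_ff_linearl ipDl ipZl.
by rewrite second_ff_linearl ipDr ipZr.
Qed.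

End immersed.

(** * Nearly trans-Sasakian structures in a chart *)

Section contact_chart.
Context (R : realType) (n : nat) (M : charted R n) (S : contact_data M).
Context (M_mfd : smooth_manifold M) (S_acm : almost_contact_metric S).
Context (d : chart M) (p : 'rV[R]_n) (Vp : chart_img d p).

Local Notation G := (gmet S d).
Local Notation ph := (phi S d).
Local Notation g := (ip (gmet S d p)).

Lemma near_chart : \forall y \near p, chart_img d y.
Proof.
by apply: open_nbhs_nbhs; split; [exact: mfd_img_open M_mfd d|exact: Vp].
Qed.

Lemma gmet_posdef : posdef (G p).
Proof.
have Sg := acm_metric S_acm.
by split; [exact: (Defs.metric_sym Sg Vp)|exact: (metric_pos Sg Vp)].
Qed.

Lemma gmet_sym_near : \forall y \near p, (G y)^T = G y.
Proof.
by apply: filterS near_chart => y; exact: (Defs.metric_sym (acm_metric S_acm)).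
Qed.

Lemma gmet_differentiable : differentiable G p.
Proof.
have sG : smooth_mx_on (chart_img d) G by exact: (metric_smooth (acm_metric S_acm)).
exact: (smooth_mx_differentiable sG Vp).
Qed.

Lemma phi_differentiable : differentiable ph p.
Proof. exact: (smooth_mx_differentiable (proj1 (acm_phi S_acm) d) Vp). Qed.

Lemma xi_differentiable : differentiable (xi S d) p.
Proof. exact: (smooth_mx_differentiable (proj1 (acm_xi S_acm) d) Vp). Qed.

Lemma etaE u : (u *m Defs.eta S d p) 0 0 = g u (xi S d p).
Proof. exact: (acm_eta_dual S_acm Vp u). Qed.

Lemma xi_unit : g (xi S d p) (xi S d p) = 1.
Proof. by rewrite -etaE; exact: (acm_eta_xi S_acm Vp). Qed.

Lemma xi_phi : xi S d p *m ph p = 0.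
Proof. exact: (acm_phi_xi S_acm Vp). Qed.

Lemma ip_phi u v : g (u *m ph p) (v *m ph p) =
  g u v - g u (xi S d p) * g v (xi S d p).
Proof. by rewrite -!etaE; exact: (acm_phi_metric S_acm Vp u v). Qed.

Lemma ip_phi_xi u : g (u *m ph p) (xi S d p) = 0.
Proof. by rewrite -etaE; exact: (acm_eta_phi S_acm Vp u). Qed.

Lemma phi_phi u : u *m ph p *m ph p = - u + g u (xi S d p) *: xi S d p.
Proof. by rewrite -etaE; exact: (acm_phi2 S_acm Vp u). Qed.

Lemma phi_skew u v : g (u *m ph p) v = - g u (v *m ph p).
Proof.
have := ip_phi (u *m ph p) v; rewrite ip_phi_xi mul0r subr0 => <-.
rewrite phi_phi ipDl ipNl ipZl (ip_sym (xi S d p) _ gmet_posdef.1) ip_phi_xi.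
by rewrite mulr0 addr0.
Qed.

End contact_chart.

(** [(nabla_u phi) v]. This expression is tensorial, so constant fields through
    [u] and [v] determine it. *)
Definition phi_deriv (R : realType) n (M : charted R n) (S : contact_data M)
    (d : chart M) (p u v : 'rV[R]_n) : 'rV[R]_n :=
  nabla_phi S d (fun=> u) (fun=> v) p.

Section covariant_derivative_of_phi.
Context (R : realType) (n : nat) (M : charted R n) (S : contact_data M).
Context (M_mfd : smooth_manifold M) (S_acm : almost_contact_metric S).
Context (d : chart M) (p : 'rV[R]_n) (Vp : chart_img d p).

Local Notation G := (gmet S d).
Local Notation ph := (phi S d).
Local Notation g := (ip (gmet S d p)).
Local Notation T := (phi_deriv S d p).

Let dG := gmet_differentiable S_acm Vp.
Let dph := phi_differentiable S_acm Vp.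
Let Gsym := gmet_sym_near M_mfd S_acm Vp.
Let Gpos := gmet_posdef S_acm Vp.

Lemma derive_phi_field (v u : 'rV[R]_n) :
  derivable (fun y => v *m ph y) p u /\
  'D_u (fun y => v *m ph y) p = v *m 'D_u ph p.
Proof.
have dphu : derivable ph p u by exact: diff_derivable.
split; last exact: derive_mulmx_cst.
by have [] := is_derive_mulmx (derivable_cst v p u) dphu.
Qed.

Lemma phi_derivE u v : T u v = levi_civita G u (fun y => v *m ph y) p
  - levi_civita G u (cst v) p *m ph p.
Proof. by []. Qed.

(** Differentiate [g (phi v) (phi v) = g v v - (eta v)^2] where [eta v]
    vanishes. *)
Lemma phi_deriv_horizontal u v : g v (xi S d p) = 0 -> g (T u v) (v *m ph p) = 0.
Proof.
have key (a b : R) : a + a = b + b -> a - b = 0 by lra.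
move=> v_xi; have Gunit := posdef_unitmx Gpos.
have dGu : derivable G p u by exact: diff_derivable.
pose N := levi_civita G u (fun y => v *m ph y) p.
pose C := levi_civita G u (cst v) p.
pose q y := ip (G y) v (xi S d y).
have dv : derivable (cst v) p u by exact: derivable_cst.
have dxi : derivable (xi S d) p u by exact: diff_derivable (xi_differentiable S_acm Vp).
have metric_phi : 'D_u (fun y => ip (G y) (v *m ph y) (v *m ph y)) p =
    g N (v *m ph p) + g (v *m ph p) N.
  have dp := (derive_phi_field v u).1.
  exact: (levi_civita_metric Gsym Gunit dG dp dp).
have metric_v : 'D_u (fun y => ip (G y) v v) p = g C v + g v C.
  exact: (levi_civita_metric Gsym Gunit dG dv dv).
have dvv : derivable (fun y => ip (G y) v v) p u.
  exact: (derivable_ip dGu dv dv).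
have dq : derivable q p u.
  exact: (derivable_ip dGu dv dxi).
have same : 'D_u (fun y => ip (G y) (v *m ph y) (v *m ph y)) p =
    'D_u (fun y => ip (G y) v v) p.
  transitivity ('D_u ((fun y => ip (G y) v v) - q * q) p).
    apply: near_eq_derive; apply: filterS (near_chart M_mfd Vp) => y Vy.
    exact: ip_phi.
  rewrite (deriveB dvv (derivableM dq dq)) (deriveM dq dq).
  by rewrite (_ : q p = 0)// scale0r addr0 subr0.
move: same; rewrite metric_phi metric_v phi_derivE -/N -/C ipDl ipNl.
rewrite (ip_phi S_acm Vp) v_xi mulr0 subr0 (ip_sym (v *m ph p) N Gpos.1).
rewrite (ip_sym v C Gpos.1).
exact: key.
Qed.

End covariant_derivative_of_phi.

Section phi_along_a_map.
Context (R : realType) (n k : nat) (M : charted R n) (S : contact_data M).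
Context (M_mfd : smooth_manifold M) (S_acm : almost_contact_metric S).
Context (d : chart M) (F : 'rV[R]_k -> 'rV[R]_n) (x : 'rV[R]_k).
Context (Vx : chart_img d (F x)) (dF : differentiable F x).

Local Notation nab := (levi_civita_along (gmet S d) F).

Lemma derivable_phi_along (Y : 'rV[R]_k -> 'rV[R]_n) u :
  derivable Y x u -> derivable (fun y => Y y *m phi S d (F y)) x u.
Proof.
move=> dY; have dph := phi_differentiable S_acm Vx.
by have [] := is_derive_mulmx dY (diff_derivable (differentiable_along dF dph)).
Qed.

(** The Leibniz rule for [phi] applied to a field along a map. *)
Lemma nabla_phi_along (Y : 'rV[R]_k -> 'rV[R]_n) u : derivable Y x u ->
  nab u (fun y => Y y *m phi S d (F y)) x =
  phi_deriv S d (F x) (u *m 'J F x) (Y x) + nab u Y x *m phi S d (F x).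
Proof.
move=> dY; have dph := phi_differentiable S_acm Vx.
have dphF := diff_derivable (differentiable_along dF dph).
have [_ DY] := is_derive_mulmx dY (@dphF u).
have [_ Dv] := derive_phi_field S_acm Vx (Y x) (u *m 'J F x).
rewrite /levi_civita_along DY (derive_chain _ dF dph) phi_derivE /levi_civita Dv.
rewrite derive_cst add0r.
move: ('D_u Y x) (christoffel _ _ _ _) (christoffel _ _ _ _) ('D_ _ _ _) => a b c e.
rewrite mulmxDl; move: (_ *m _) (_ *m _) (_ *m _) => A B C.
by rewrite [RHS]addrACA addNr addr0 -addrA addrC.
Qed.

Lemma levi_civita_along_near0 (Y : 'rV[R]_k -> 'rV[R]_n) u :
  (\forall y \near x, Y y = 0) -> nab u Y x = 0.
Proof.
move=> Y0; have dG := gmet_differentiable S_acm Vx.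
rewrite /levi_civita_along (nbhs_singleton Y0).
have -> : 'D_u Y x = 'D_u (cst 0) x by exact: near_eq_derive.
rewrite derive_cst add0r; have := christoffel_linear dG 1 (u *m 'J F x) 0 0.
by rewrite scaler0 addr0 scale1r => /esym/eqP; rewrite -subr_eq0 addrK => /eqP.
Qed.

End phi_along_a_map.

Lemma nearly_trans_sasakian_phi_deriv (R : realType) n (M : charted R n)
    (S : contact_data M) (alpha beta : M -> R) (d : chart M) p u v :
    almost_contact_metric S ->
    nearly_trans_sasakian S alpha beta -> chart_img d p ->
  phi_deriv S d p u v + phi_deriv S d p v u =
    alpha (chart_inv d p) *:
      ((2 * ip (gmet S d p) u v) *: xi S d p
       - ip (gmet S d p) v (xi S d p) *: u - ip (gmet S d p) u (xi S d p) *: v)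
    - beta (chart_inv d p) *:
      (ip (gmet S d p) v (xi S d p) *: (u *m phi S d p)
       + ip (gmet S d p) u (xi S d p) *: (v *m phi S d p)).
Proof.
move=> S_acm S_nts Vp; rewrite -!(etaE S_acm Vp).
apply: (S_nts d (fun=> u) (fun=> v)); last exact: Vp.
  exact: smooth_mx_on_cst.
exact: smooth_mx_on_cst.
Qed.

(** * Affine slices of an immersion *)

Section affine_slices.
Context (R : realType) (k n n' : nat) (K : 'rV[R]_n -> 'rV[R]_n').
Context (A : 'M[R]_(k, n)) (b : 'rV[R]_n) (z : 'rV[R]_k).

Local Notation slice := (fun w : 'rV[R]_k => w *m A + b).
Local Notation Kslice := (fun w : 'rV[R]_k => K (w *m A + b)).

Lemma differentiable_affine w : differentiable slice w.
Proof.
apply: differentiableD; last exact: differentiable_cst.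
apply: (differentiable_mulmx (M := id)); last exact: differentiable_cst.
by have [] := is_diff_id w.
Qed.

Lemma jacobian_affine w : differentiable K (w *m A + b) ->
  'J Kslice w = A *m 'J K (w *m A + b).
Proof.
move=> dK; apply/row_matrixP => i; rewrite !rowE mulmxA.
have dKs := differentiable_along (differentiable_affine w) dK.
by rewrite -(deriveEjacobian _ dKs) -(deriveEjacobian _ dK) derive_affine.
Qed.

Context (Kreg : regular_at K (z *m A + b)).

Lemma slice_near : \forall w \near z, differentiable K (w *m A + b).
Proof.
have cs := differentiable_continuous (differentiable_affine z).
exact: (cs _ (regular_near Kreg)).
Qed.

Lemma slice_jacobian_near :
  \forall w \near z, A *m 'J K (w *m A + b) = 'J Kslice w.
Proof. by apply: filterS slice_near => w dK; rewrite jacobian_affine. Qed.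

Lemma slice_regular : regular_at Kslice z.
Proof.
have dJ := regular_jacobian Kreg.
have dJs := differentiable_along (differentiable_affine z) dJ.
have DJ u : 'D_u (jacobian Kslice) z = A *m 'D_(u *m A) (jacobian K) (z *m A + b).
  transitivity ('D_u (fun w => A *m 'J K (w *m A + b)) z).
    by apply: near_eq_derive; apply: filterS slice_jacobian_near.
  by rewrite (derive_mulmx_cst A (diff_derivable dJs)) derive_affine.
split.
- apply: filterS slice_near => w; exact: differentiable_along (differentiable_affine w).
- apply: (near_eq_differentiable slice_jacobian_near).
  exact: (differentiable_mulmx (differentiable_cst A z) dJs).
by move=> u v; rewrite !DJ !mulmxA; exact: (regular_hessian Kreg).
Qed.

Context (G : 'rV[R]_n' -> 'M[R]_n').

Lemma coord_deriv_slice u v :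
  coord_deriv G Kslice z u v = coord_deriv G K (z *m A + b) (u *m A) (v *m A).
Proof.
have dK := nbhs_singleton (regular_near Kreg).
have dJ := regular_jacobian Kreg.
have dvJ := diff_derivable (differentiable_mulmx (differentiable_cst (v *m A) _) dJ).
have JE := jacobian_affine dK.
rewrite /coord_deriv /levi_civita_along JE.
rewrite (mulmxA u A) (mulmxA v A); apply: (congr1 (fun s => s + _)).
transitivity ('D_u (fun w => v *m A *m 'J K (w *m A + b)) z).
  apply: near_eq_derive; apply: filterS slice_jacobian_near => w <-.
  exact: mulmxA.
exact: (derive_affine (fun y => v *m A *m 'J K y)).
Qed.

Context (dG : differentiable G (K (z *m A + b))).
Context (Gsym : \forall y \near K (z *m A + b), (G y)^T = G y).
Context (Gpos : posdef (G (K (z *m A + b)))).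
Context (Kinj : injective (fun u : 'rV[R]_n => u *m 'J K (z *m A + b))).
Context (Ainj : injective (fun u : 'rV[R]_k => u *m A)).

Let tangent (w : 'rV[R]_k) := w *m A *m 'J K (z *m A + b).

(** The second fundamental form of the slice and [nu] are both normal to the
    slice, and their difference is tangent to it. *)
Lemma second_ff_slice u v w nu :
    coord_deriv G K (z *m A + b) (u *m A) (v *m A) = tangent w + nu ->
    (forall t, ip (G (K (z *m A + b))) nu (tangent t) = 0) ->
  second_ff G Kslice z u v = nu.
Proof.
move=> Lsplit nu_normal; have dK := nbhs_singleton (regular_near Kreg).
have JE : 'J Kslice z = A *m 'J K (z *m A + b) by exact: jacobian_affine.
have Kslice_inj : injective (fun u : 'rV[R]_k => u *m 'J Kslice z).
  by move=> s t; rewrite JE !mulmxA => /Kinj/Ainj.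
have h_normal := second_ff_normal slice_regular dG Gsym Gpos Kslice_inj u v.
pose Gam := christoffel (induced_metric G Kslice) z u v.
have hE : second_ff G Kslice z u v = nu + (w - Gam) *m 'J Kslice z.
  rewrite second_ffE coord_deriv_slice Lsplit /tangent JE mulmxBl !mulmxA.
  by rewrite [in RHS]addrA [_ + nu]addrC.
suff wGam : w - Gam = 0 by rewrite hE wGam mul0mx addr0.
apply: (tangent_normal_eq0 Gpos Kslice_inj) => t.
have := h_normal t; rewrite hE ipDl => /eqP.
have -> : ip (G (K (z *m A + b))) nu (t *m 'J Kslice z) = 0.
  by rewrite JE mulmxA nu_normal.
by rewrite add0r => /eqP.
Qed.

End affine_slices.

(** * Product charts *)

Section product_charts.
Context (R : realType) (n n1 n2 : nat).
Context (M : charted R n) (N1 : charted R n1) (N2 : charted R n2).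
Context (N1_mfd : smooth_manifold N1) (N2_mfd : smooth_manifold N2).
Context (M_mfd : smooth_manifold M).

Lemma chart_img_prodP (c : chart (prod_charted N1 N2)) x :
  chart_img c x <-> chart_img c.1 (lsubmx x) /\ chart_img c.2 (rsubmx x).
Proof.
split=> [[[p1 p2] [p1c p2c] <-]|[[p1 p1c p1x] [p2 p2c p2x]]].
  by rewrite /= row_mxKl row_mxKr; split; [exists p1|exists p2].
by exists (p1, p2) => //=; rewrite p1x p2x hsubmxK.
Qed.

Lemma rep_dom_open (F : prod_charted N1 N2 -> M) c d :
  continuous F -> open (rep_dom F c d).
Proof.
move=> Fcont; rewrite openE => x [/chart_img_prodP[x1c x2c] Fx].
have near1 : \forall y \near x, chart_img c.1 (lsubmx y).
  apply: (@continuous_lsubmx R 1 n1 n2 x); apply: open_nbhs_nbhs.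
  by split; [exact: mfd_img_open N1_mfd c.1|exact: x1c].
have near2 : \forall y \near x, chart_img c.2 (rsubmx y).
  apply: (@continuous_rsubmx R 1 n1 n2 x); apply: open_nbhs_nbhs.
  by split; [exact: mfd_img_open N2_mfd c.2|exact: x2c].
have nearF : \forall y \near x, chart_dom d (F (chart_inv c y)).
  have Finv : (fun y => F (chart_inv c y)) @ x --> F (chart_inv c x).
    have c1 : {for x, continuous (chart_inv c.1 \o lsubmx)}.
      apply: continuous_comp; first exact: continuous_lsubmx.
      exact: (mfd_point_cont N1_mfd x1c).
    have c2 : {for x, continuous (chart_inv c.2 \o rsubmx)}.
      apply: continuous_comp; first exact: continuous_rsubmx.
      exact: (mfd_point_cont N2_mfd x2c).
    have c12 : {for x, continuous (chart_inv c)}.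
      have : (fun y => ((chart_inv c.1 \o lsubmx) y, (chart_inv c.2 \o rsubmx) y)) @ x
          --> ((chart_inv c.1 \o lsubmx) x, (chart_inv c.2 \o rsubmx) x).
        exact: (@cvg_pair _ _ _ _ _ _ (nbhs_filter x) (nbhs_filter _)
          (nbhs_filter _) _ _ c1 c2).
      by [].
    exact: (continuous_comp c12 (Fcont _)).
  apply: Finv; apply: open_nbhs_nbhs.
  by split; [exact: mfd_dom_open M_mfd d|exact: Fx].
rewrite /interior/=; near=> y; split.
  by apply/chart_img_prodP; split; near: y.
by near: y.
Unshelve. all: by end_near. Qed.

Lemma rep_dom_chart (N : charted R n1) (F : N -> M) c d x :
  rep_dom F c d x -> chart_img d (local_rep F c d x).
Proof. by case=> _ Fx; exists (F (chart_inv c x)). Qed.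

Lemma local_repK (N : charted R n1) (F : N -> M) c d x :
  rep_dom F c d x -> chart_inv d (local_rep F c d x) = F (chart_inv c x).
Proof. by case=> _ Fx; exact: (mfd_coordK M_mfd Fx). Qed.

End product_charts.

(** * Warped product semi-slant immersions in coordinates *)

Definition hor (R : realType) n1 n2 (a : 'rV[R]_n1) : 'rV[R]_(n1 + n2) := row_mx a 0.
Definition ver (R : realType) n1 n2 (b : 'rV[R]_n2) : 'rV[R]_(n1 + n2) := row_mx 0 b.
Arguments hor {R n1 n2}.
Arguments ver {R n1 n2}.

Definition hor_mx (R : realType) n1 n2 : 'M[R]_(n1, n1 + n2) := row_mx 1%:M 0.
Definition ver_mx (R : realType) n1 n2 : 'M[R]_(n2, n1 + n2) := row_mx 0 1%:M.
Arguments hor_mx {R n1 n2}.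
Arguments ver_mx {R n1 n2}.

Section hor_ver.
Context (R : realType) (n1 n2 : nat).
Implicit Types (a : 'rV[R]_n1) (b : 'rV[R]_n2).

Lemma hor_linear k a a' : hor (n2 := n2) (k *: a + a') = k *: hor a + hor a'.
Proof. by rewrite /hor scale_row_mx add_row_mx scaler0 addr0. Qed.

Lemma ver_linear k b b' : ver (n1 := n1) (k *: b + b') = k *: ver b + ver b'.
Proof. by rewrite /ver scale_row_mx add_row_mx scaler0 addr0. Qed.

Lemma hor_ver_split (u : 'rV[R]_(n1 + n2)) : u = hor (lsubmx u) + ver (rsubmx u).
Proof. by rewrite /hor /ver add_row_mx addr0 add0r hsubmxK. Qed.

Lemma lsub_hor a : lsubmx (hor (n2 := n2) a) = a. Proof. exact: row_mxKl. Qed.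
Lemma rsub_hor a : rsubmx (hor (n2 := n2) a) = 0. Proof. exact: row_mxKr. Qed.
Lemma lsub_ver b : lsubmx (ver (n1 := n1) b) = 0. Proof. exact: row_mxKl. Qed.
Lemma rsub_ver b : rsubmx (ver (n1 := n1) b) = b. Proof. exact: row_mxKr. Qed.

Lemma mul_hor_mx a : a *m hor_mx = hor a :> 'rV[R]_(n1 + n2).
Proof. by rewrite mul_mx_row mulmx1 mulmx0. Qed.
Lemma mul_ver_mx b : b *m ver_mx = ver b :> 'rV[R]_(n1 + n2).
Proof. by rewrite mul_mx_row mulmx1 mulmx0. Qed.

Lemma hor_slice a b : a *m hor_mx + ver b = row_mx a b.
Proof. by rewrite mul_hor_mx add_row_mx addr0 add0r. Qed.
Lemma ver_slice a b : b *m ver_mx + hor a = row_mx a b.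
Proof. by rewrite mul_ver_mx add_row_mx addr0 add0r. Qed.

Definition hor_verE := (lsub_hor, rsub_hor, lsub_ver, rsub_ver).

End hor_ver.

Section warped_chart.
Context (R : realType) (n n1 n2 : nat).
Context (M : charted R n) (N1 : charted R n1) (N2 : charted R n2).
Context (S : contact_data M).
Context (g1 : chart N1 -> 'rV[R]_n1 -> 'M[R]_n1).
Context (g2 : chart N2 -> 'rV[R]_n2 -> 'M[R]_n2) (f : N1 -> R) (theta : R).
Context (F : prod_charted N1 N2 -> M).
Context (M_mfd : smooth_manifold M) (S_acm : almost_contact_metric S).
Context (F_wss : warped_semi_slant S g1 g2 f theta F).
Context (xi_N1 : forall p2, xi_tangent S (leaf1 F p2)).
Context (c : chart (prod_charted N1 N2)) (d : chart M).

Local Notation Fh := (local_rep F c d).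
Local Notation U := (rep_dom F c d).
Local Notation gI := (induced_metric (gmet S d) Fh).

Definition warp (f : N1 -> R) (c : chart (prod_charted N1 N2))
  (y : 'rV[R]_(n1 + n2)) : R := f (chart_inv c.1 (lsubmx y)).

Lemma warped_open : open U.
Proof.
have [cF _] := (wss_immersion F_wss).1.
exact: (rep_dom_open (wss_manifold1 F_wss) (wss_manifold2 F_wss) M_mfd cF).
Qed.

Lemma warped_near y : U y -> \forall z \near y, U z.
Proof. by move=> Uy; apply: open_nbhs_nbhs; split; [exact: warped_open|exact: Uy]. Qed.

Lemma warped_regular y : U y -> regular_at Fh y.
Proof.
move=> Uy; have [_ sF] := (wss_immersion F_wss).1.
exact: (smooth_regular warped_open (sF c d) Uy).
Qed.

Lemma warped_differentiable y : U y -> differentiable Fh y.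
Proof. by move=> /warped_regular/regular_near; exact: nbhs_singleton. Qed.

Lemma warped_injective y : U y -> injective (fun u : 'rV[R]_(n1 + n2) => u *m 'J Fh y).
Proof. exact: (wss_immersion F_wss).2. Qed.

Lemma warped_in_chart y : U y -> chart_img d (Fh y).
Proof. exact: rep_dom_chart. Qed.

Lemma warped_charts y : U y -> chart_img c.1 (lsubmx y) /\ chart_img c.2 (rsubmx y).
Proof. by case=> /chart_img_prodP. Qed.

Lemma factor1_posdef y : U y -> posdef (g1 c.1 (lsubmx y)).
Proof.
move=> /warped_charts[y1 _]; have Sg := wss_metric1 F_wss.
by split; [exact: (Defs.metric_sym Sg y1)|exact: (metric_pos Sg y1)].
Qed.

Lemma factor2_posdef y : U y -> posdef (g2 c.2 (rsubmx y)).
Proof.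
move=> /warped_charts[_ y2]; have Sg := wss_metric2 F_wss.
by split; [exact: (Defs.metric_sym Sg y2)|exact: (metric_pos Sg y2)].
Qed.

Lemma warp_gt0 y : 0 < warp f c y. Proof. exact: wss_f_pos F_wss _. Qed.

Lemma warp_differentiable y : U y -> differentiable (warp f c) y.
Proof.
move=> /warped_charts[y1 _]; have sf := wss_f_smooth F_wss.
have df := smooth_differentiable (sf c.1) y1.
exact: (differentiable_comp (differentiable_lsubmx y) df).
Qed.

Lemma warped_induced_posdef y : U y -> posdef (gI y).
Proof.
move=> Uy; apply: (induced_posdef _ (warped_injective Uy)).
exact: (gmet_posdef S_acm (warped_in_chart Uy)).
Qed.

(** Polarization: the warped product structure only prescribes the quadratic
    form. *)
Lemma warped_ip y u v : U y -> ip (gI y) u v =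
  ip (g1 c.1 (lsubmx y)) (lsubmx u) (lsubmx v)
  + warp f c y ^+ 2 * ip (g2 c.2 (rsubmx y)) (rsubmx u) (rsubmx v).
Proof.
move=> Uy; have W w := wss_warped F_wss Uy w.
have := W (u + v); rewrite !linearD !ipDl !ipDr -/(warp f c y).
rewrite (ip_sym v u (warped_induced_posdef Uy).1).
rewrite (ip_sym (lsubmx v) (lsubmx u) (factor1_posdef Uy).1).
rewrite (ip_sym (rsubmx v) (rsubmx u) (factor2_posdef Uy).1).
rewrite (W u) (W v) -/(warp f c y).
have key (a b c' e p q r k s : R) : a + k * b + s + (s + (p + k * q)) =
    a + c' + (c' + p) + k * (b + e + (e + q)) -> s = c' + k * e by lra.
exact: key.
Qed.

Lemma warped_hor_ver y a b : U y -> ip (gI y) (hor a) (ver b) = 0.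
Proof. by move=> Uy; rewrite (warped_ip _ _ Uy) !hor_verE ip0r ip0l mulr0 addr0. Qed.

Lemma warped_hor_hor y a a' : U y ->
  ip (gI y) (hor a) (hor a') = ip (g1 c.1 (lsubmx y)) a a'.
Proof. by move=> Uy; rewrite (warped_ip _ _ Uy) !hor_verE ip0l mulr0 addr0. Qed.

Lemma warped_ver_ver y b b' : U y -> ip (gI y) (ver b) (ver b') =
  warp f c y ^+ 2 * ip (g2 c.2 (rsubmx y)) b b'.
Proof. by move=> Uy; rewrite (warped_ip _ _ Uy) !hor_verE ip0l add0r. Qed.

(** ** The factors as submanifolds *)

Lemma leaf1_rep x2 : local_rep (leaf1 F (chart_inv c.2 x2)) c.1 d =
  (fun z => Fh (z *m hor_mx + ver x2)).
Proof.
by apply/funext => z; rewrite hor_slice /local_rep /leaf1 /= row_mxKl row_mxKr.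
Qed.

Lemma leaf2_rep x1 : local_rep (leaf2 F (chart_inv c.1 x1)) c.2 d =
  (fun z => Fh (z *m ver_mx + hor x1)).
Proof.
by apply/funext => z; rewrite ver_slice /local_rep /leaf2 /= row_mxKl row_mxKr.
Qed.

Lemma leaf1_slice (y : 'rV[R]_(n1 + n2)) : lsubmx y *m hor_mx + ver (rsubmx y) = y.
Proof. by rewrite hor_slice hsubmxK. Qed.

Lemma leaf2_slice (y : 'rV[R]_(n1 + n2)) : rsubmx y *m ver_mx + hor (lsubmx y) = y.
Proof. by rewrite ver_slice hsubmxK. Qed.

Lemma leaf1_dom y : U y ->
  rep_dom (leaf1 F (chart_inv c.2 (rsubmx y))) c.1 d (lsubmx y).
Proof. by move=> Uy; split; [have [] := warped_charts Uy|case: Uy]. Qed.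

Lemma leaf2_dom y : U y ->
  rep_dom (leaf2 F (chart_inv c.1 (lsubmx y))) c.2 d (rsubmx y).
Proof. by move=> Uy; split; [have [] := warped_charts Uy|case: Uy]. Qed.

Lemma leaf1_point y :
  local_rep (leaf1 F (chart_inv c.2 (rsubmx y))) c.1 d (lsubmx y) = Fh y.
Proof. by rewrite leaf1_rep leaf1_slice. Qed.

Lemma leaf2_point y :
  local_rep (leaf2 F (chart_inv c.1 (lsubmx y))) c.2 d (rsubmx y) = Fh y.
Proof. by rewrite leaf2_rep leaf2_slice. Qed.

Lemma leaf1_jacobian y a : U y ->
  a *m 'J (local_rep (leaf1 F (chart_inv c.2 (rsubmx y))) c.1 d) (lsubmx y) =
  hor a *m 'J Fh y.
Proof.
move=> Uy; rewrite leaf1_rep jacobian_affine leaf1_slice ?mulmxA ?mul_hor_mx//.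
exact: warped_differentiable.
Qed.

Lemma leaf2_jacobian y b : U y ->
  b *m 'J (local_rep (leaf2 F (chart_inv c.1 (lsubmx y))) c.2 d) (rsubmx y) =
  ver b *m 'J Fh y.
Proof.
move=> Uy; rewrite leaf2_rep jacobian_affine leaf2_slice ?mulmxA ?mul_ver_mx//.
exact: warped_differentiable.
Qed.

Lemma phi_hor y a : U y -> exists a',
  hor a *m 'J Fh y *m phi S d (Fh y) = hor a' *m 'J Fh y.
Proof.
move=> Uy.
have [a' aa'] := wss_invariant F_wss (leaf1_dom Uy) a.
by exists a'; rewrite leaf1_point !leaf1_jacobian// in aa'.
Qed.

Lemma xi_hor y : U y -> exists k, xi S d (Fh y) = hor k *m 'J Fh y.
Proof.
move=> Uy; have [k xik] := xi_N1 (leaf1_dom Uy).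
by exists k; rewrite leaf1_point leaf1_jacobian// in xik.
Qed.

Local Notation g y := (ip (gmet S d (Fh y))).
Local Notation E y v := (v *m 'J Fh y).

Lemma ip_field y u v : g y (E y u) (E y v) = ip (gI y) u v.
Proof. by rewrite ip_induced. Qed.

Lemma ver_xi y b : U y -> g y (E y (ver b)) (xi S d (Fh y)) = 0.
Proof.
move=> Uy; have [k ->] := xi_hor Uy.
by rewrite ip_field (ip_sym _ _ (warped_induced_posdef Uy).1) warped_hor_ver.
Qed.

(** The fundamental 2-form restricted to the second factor. *)
Definition slant_form (y : 'rV[R]_(n1 + n2)) (b b' : 'rV[R]_n2) : R :=
  g y (E y (ver b) *m phi S d (Fh y)) (E y (ver b')).

Definition ver_metric (y : 'rV[R]_(n1 + n2)) : 'M[R]_n2 :=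
  warp f c y ^+ 2 *: g2 c.2 (rsubmx y).

Lemma ver_metricE y b b' : ip (ver_metric y) b b' =
  warp f c y ^+ 2 * ip (g2 c.2 (rsubmx y)) b b'.
Proof. by rewrite /ver_metric /ip -scalemxAr -scalemxAl [LHS]mxE. Qed.

Lemma ip_ver y b b' : U y -> ip (gI y) (ver b) (ver b') = ip (ver_metric y) b b'.
Proof. by move=> Uy; rewrite warped_ver_ver// ver_metricE. Qed.

Lemma ver_metric_posdef y : U y -> posdef (ver_metric y).
Proof.
move=> Uy; have [s p] := factor2_posdef Uy; split.
  by rewrite /ver_metric linearZ/= s.
move=> b b0; rewrite -ip_ver// warped_ver_ver// mulr_gt0 ?exprn_gt0 ?warp_gt0//.
exact: p.
Qed.

Lemma slant_form_skew y b b' : U y -> slant_form y b b' = - slant_form y b' b.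
Proof.
move=> Uy; have Vy := warped_in_chart Uy.
rewrite /slant_form (phi_skew S_acm Vy).
by rewrite (ip_sym (E y (ver b)) _ (gmet_posdef S_acm Vy).1).
Qed.

(** The slant condition: the tangential part of [phi b], expanded in an
    orthonormal frame of the factor, has length [cos theta] times that of
    [b]. *)
Lemma slant_form_norm y b e : U y -> orthonormal_frame (ver_metric y) e ->
  \sum_k slant_form y b (e k) ^+ 2 = cos theta ^+ 2 * ip (ver_metric y) b b.
Proof.
move=> Uy eON; have Vy := warped_in_chart Uy.
have Gpos := gmet_posdef S_acm Vy.
have [->|b0] := eqVneq b 0.
  rewrite ip0l mulr0; apply: big1 => k _.
  by rewrite /slant_form /ver row_mx0 !mul0mx ip0l expr0n.
have Eb0 : E y (ver b) != 0.
  apply: contra_neq b0 => Eb0; rewrite -(rsub_ver n1 b).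
  rewrite (_ : ver b = 0) ?linear0//; apply: (warped_injective Uy).
  by rewrite Eb0 mul0mx.
have Eb_xi a : E y (ver b) != a *: xi S d (Fh y).
  apply/eqP => Eb; have := Gpos.2 _ Eb0.
  by rewrite {2}Eb ipZr ver_xi// mulr0 ltxx.
have := wss_slant F_wss (leaf2_dom Uy).
rewrite leaf2_point => /(_ b); rewrite leaf2_jacobian//.
move=> /(_ Eb0 Eb_xi)[t [[v _ vt] tperp thE]].
rewrite leaf2_jacobian// in vt.
pose w := E y (ver b) *m phi S d (Fh y).
have perp v' : g y (w - t) (E y (ver v')) = 0.
  by apply: tperp; exists v' => //; rewrite leaf2_jacobian.
have w2 : g y w w = ip (ver_metric y) b b.
  by rewrite (ip_phi S_acm Vy) ver_xi// mulr0 subr0 ip_field ip_ver.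
have t2 : g y t t = \sum_k slant_form y b (e k) ^+ 2.
  rewrite -vt ip_field ip_ver// (parseval v v eON); apply: eq_bigr => k _.
  rewrite (ip_sym (e k) v (ver_metric_posdef Uy).1) -expr2; congr (_ ^+ 2).
  rewrite -ip_ver// -ip_field vt; apply/esym/eqP.
  by rewrite -subr_eq0 -(perp (e k)) ipDl ipNl.
have tw : g y t t <= g y w w.
  have wt := perp v; rewrite vt ipDl ipNl in wt.
  have := posdef_ge0 (w - t) Gpos; rewrite ipDl !ipDr !ipNl !ipNr.
  rewrite (ip_sym t w Gpos.1).
  have key (p q r : R) : r - q = 0 -> 0 <= p - r + (- r - - q) -> q <= p by lra.
  by move=> le0; exact: key wt le0.
have w_gt0 : 0 < g y w w by rewrite w2; exact: (ver_metric_posdef Uy).2.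
rewrite -t2 -w2 -(mnorm_sqr t Gpos) -(mnorm_sqr w Gpos).
apply: cos_acos_ratio thE; first exact: sqrtr_ge0.
  by rewrite sqrtr_gt0.
by rewrite !mnorm_sqr.
Qed.

Section at_a_point.
Context (x : 'rV[R]_(n1 + n2)) (Ux : U x).

Local Notation G := (gmet S d (Fh x)).
Local Notation J v := (v *m 'J Fh x).
Local Notation ph := (phi S d (Fh x)).
Local Notation L := (coord_deriv (gmet S d) Fh x).
Local Notation h := (second_ff (gmet S d) Fh x).

Let Freg := warped_regular Ux.
Let dF := warped_differentiable Ux.
Let Vx := warped_in_chart Ux.
Let Gpos := gmet_posdef S_acm Vx.
Let dG := gmet_differentiable S_acm Vx.
Let Gsym := gmet_sym_near M_mfd S_acm Vx.
Let Unear := warped_near Ux.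
Let Finj := warped_injective Ux.
Let gIpos := warped_induced_posdef Ux.

(** ** Derivatives of the warped metric *)

Definition dlnf (a : 'rV[R]_n1) : R := 'D_(hor a) (fun y => ln (warp f c y)) x.

Lemma lnf_differentiable : differentiable (fun y => ln (warp f c y)) x.
Proof. exact: (derive_ln 0 (warp_gt0 x) (warp_differentiable Ux)).1. Qed.

Lemma derive_warp a : 'D_(hor a) (warp f c) x = warp f c x * dlnf a.
Proof.
rewrite /dlnf (derive_ln (hor a) (warp_gt0 x) (warp_differentiable Ux)).2.
by rewrite mulrA divff ?mul1r// gt_eqF// warp_gt0.
Qed.

Lemma derive_lnf_ver b : 'D_(ver b) (fun y => ln (warp f c y)) x = 0.
Proof.
rewrite (derive_lsubmx (fun z => ln (f (chart_inv c.1 z)))) lsub_ver.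
exact: derive0.
Qed.

Lemma dlnf_linear k a a' : dlnf (k *: a + a') = k * dlnf a + dlnf a'.
Proof. by rewrite /dlnf hor_linear (deriveP _ _ _ lnf_differentiable). Qed.

Lemma derive_metric_hor_ver u a b :
  'D_u (fun y => ip (gI y) (hor a) (ver b)) x = 0.
Proof.
transitivity ('D_u (cst (0 : R) : 'rV[R]_(n1 + n2) -> R) x).
  by apply: near_eq_derive; apply: filterS Unear => y Uy; exact: warped_hor_ver.
exact: derive_cst.
Qed.

Lemma derive_metric_ver_hor u a b :
  'D_u (fun y => ip (gI y) (ver b) (hor a)) x = 0.
Proof.
rewrite -(derive_metric_hor_ver u a b).
apply: near_eq_derive; apply: filterS Unear => y Uy.
exact: ip_sym (warped_induced_posdef Uy).1.
Qed.

Lemma derive_metric_hor_hor b a a' :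
  'D_(ver b) (fun y => ip (gI y) (hor a) (hor a')) x = 0.
Proof.
transitivity ('D_(ver b) (fun y : 'rV[R]_(n1 + n2) => ip (g1 c.1 (lsubmx y)) a a') x).
  by apply: near_eq_derive; apply: filterS Unear => y Uy; exact: warped_hor_hor.
rewrite (derive_lsubmx (fun z => ip (g1 c.1 z) a a')) lsub_ver.
exact: derive0.
Qed.

Lemma derive_metric_ver_ver a b b' :
  'D_(hor a) (fun y => ip (gI y) (ver b) (ver b')) x =
  2 * dlnf a * ip (ver_metric x) b b'.
Proof.
pose k (z : 'rV[R]_n2) := ip (g2 c.2 z) b b'.
have dw : derivable (warp f c) x (hor a).
  exact: diff_derivable (warp_differentiable Ux).
have [dk Dk] := is_derive_rsubmx0 k x (rsub_hor n2 a).
transitivity ('D_(hor a) (warp f c * warp f c * (fun y => k (rsubmx y))) x).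
  apply: near_eq_derive; apply: filterS Unear => y Uy.
  by rewrite warped_ver_ver.
have dww := derivableM dw dw.
rewrite (deriveM dww dk) Dk (deriveM dw dw) derive_warp -ip_ver// warped_ver_ver//.
rewrite scaler0 add0r.
have key (r w l : R) : r * (w * (w * l) + w * (w * l)) = 2 * l * (w ^+ 2 * r) by ring.
exact: key.
Qed.

(** ** The ambient derivative of coordinate fields *)

Lemma coord_deriv_ver_hor a b b' :
  ip G (L (ver b) (ver b')) (J (hor a)) = - (dlnf a * ip (ver_metric x) b b').
Proof.
rewrite (koszul Freg dG Gsym Gpos) !derive_metric_ver_hor derive_metric_ver_ver.
have key (r l : R) : 2^-1 * (0 + 0 - 2 * l * r) = - (l * r) by field.
exact: key.
Qed.

Lemma coord_deriv_hor_ver a a' b :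
  ip G (L (hor a) (hor a')) (J (ver b)) = 0.
Proof.
rewrite (koszul Freg dG Gsym Gpos) !derive_metric_hor_ver derive_metric_hor_hor.
have key : 2^-1 * (0 + 0 - 0) = 0 :> R by ring.
exact: key.
Qed.

Lemma coord_deriv_mixed_hor a b a' :
  ip G (L (hor a) (ver b)) (J (hor a')) = 0.
Proof.
rewrite (koszul Freg dG Gsym Gpos) derive_metric_ver_hor derive_metric_hor_hor.
rewrite derive_metric_hor_ver.
have key : 2^-1 * (0 + 0 - 0) = 0 :> R by ring.
exact: key.
Qed.

Lemma coord_deriv_mixed_ver a b b' :
  ip G (L (hor a) (ver b)) (J (ver b')) = dlnf a * ip (ver_metric x) b b'.
Proof.
rewrite (koszul Freg dG Gsym Gpos) derive_metric_ver_ver !derive_metric_hor_ver.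
have key (r l : R) : 2^-1 * (2 * l * r + 0 - 0) = l * r by field.
exact: key.
Qed.

Lemma tangent_eq u v : (forall a, ip (gI x) u (hor a) = ip (gI x) v (hor a)) ->
  (forall b, ip (gI x) u (ver b) = ip (gI x) v (ver b)) -> u = v.
Proof.
move=> uv1 uv2; apply/eqP; rewrite -subr_eq0; apply/eqP.
apply: (posdef_eq0 gIpos); rewrite {2}[u - v]hor_ver_split ipDr.
by rewrite !ipDl !ipNl uv1 uv2 !subrr addr0.
Qed.

Lemma second_ff_tangential u v w :
  ip (gI x) (christoffel gI x u v) w = ip G (L u v) (J w).
Proof.
have := second_ff_normal Freg dG Gsym Gpos Finj u v w.
rewrite (second_ffE _ _ _ u) ipDl ipNl -ip_induced => /eqP.
by rewrite subr_eq0 => /eqP ->.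
Qed.

(** The Levi-Civita connection of the warped product has
    [nabla_X Z = (X ln f) Z]. *)
Lemma coord_deriv_mixed a b :
  L (hor a) (ver b) = dlnf a *: J (ver b) + h (hor a) (ver b).
Proof.
rewrite second_ffE (_ : christoffel _ _ _ _ = dlnf a *: ver b).
  by rewrite -scalemxAl addrC subrK.
apply: tangent_eq => [a'|b']; rewrite second_ff_tangential ipZl.
  by rewrite coord_deriv_mixed_hor (ip_sym _ _ gIpos.1) warped_hor_ver// mulr0.
by rewrite coord_deriv_mixed_ver ip_ver.
Qed.

(** ** The nearly trans-Sasakian identity on mixed vectors *)

Local Notation T := (phi_deriv S d (Fh x)).
Local Notation om := (slant_form x).
Local Notation vm := (ver_metric x).
Local Notation xix := (xi S d (Fh x)).
Local Notation nab := (levi_civita_along (gmet S d) Fh).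

(** The component of [h] that enters the estimate; as [h] is normal, only the
    normal part of [phi b'] matters. *)
Definition mixed_ff (a : 'rV[R]_n1) (b b' : 'rV[R]_n2) : R :=
  ip G (h (hor a) (ver b)) (J (ver b') *m ph).

Definition dslant (a : 'rV[R]_n1) (b b' : 'rV[R]_n2) : R :=
  'D_(hor a) (fun y => slant_form y b b') x.

(** The covariant derivative of the fundamental form of the second factor in
    horizontal directions; the slant condition alone does not make it vanish. *)
Definition cov_slant (a : 'rV[R]_n1) (b b' : 'rV[R]_n2) : R :=
  dslant a b b' - 2 * dlnf a * om b b'.

Let dfield (u v : 'rV[R]_(n1 + n2)) : derivable (fun y => v *m 'J Fh y) x u.
Proof. exact: derivable_coord_field. Qed.

Let dphi_field (u v : 'rV[R]_(n1 + n2)) :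
  derivable (fun y => v *m 'J Fh y *m phi S d (Fh y)) x u.
Proof. exact: (derivable_phi_along S_acm Vx dF (@dfield u v)). Qed.

Lemma coord_deriv_mixed_phi a b b' :
  ip G (L (hor a) (ver b)) (J (ver b') *m ph) = mixed_ff a b b' - dlnf a * om b b'.
Proof.
rewrite coord_deriv_mixed ipDl ipZl addrC -/(mixed_ff a b b'); congr (_ + _).
rewrite /slant_form (phi_skew S_acm Vx (J (ver b))).
by rewrite mulrN opprK.
Qed.

(** [phi X] stays orthogonal to the second factor; differentiate this along the
    second factor. *)
Lemma phi_deriv_ver_hor a a' b b' : J (hor a) *m ph = J (hor a') ->
  ip G (T (J (ver b)) (J (hor a))) (J (ver b')) =
  dlnf a' * ip vm b b' + mixed_ff a b b' - dlnf a * om b b'.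
Proof.
move=> aa'; pose Y y := hor a *m 'J Fh y *m phi S d (Fh y).
have ortho : 'D_(ver b) (fun y => ip (gmet S d (Fh y)) (Y y) (ver b' *m 'J Fh y)) x = 0.
  transitivity ('D_(ver b) (cst (0 : R) : 'rV[R]_(n1 + n2) -> R) x);
    last exact: derive_cst.
  apply: near_eq_derive; apply: filterS Unear => y Uy.
  rewrite /Y; have [a'' ->] := phi_hor a Uy.
  by rewrite ip_field warped_hor_ver.
move: ortho; rewrite (levi_civita_along_metric dF dG Gsym Gpos
  (@dphi_field (ver b) (hor a)) (@dfield (ver b) (ver b'))).
rewrite (nabla_phi_along S_acm Vx dF (@dfield (ver b) (hor a))) aa'.
rewrite -/(coord_deriv _ _ _ _ _) -/(coord_deriv _ _ _ _ _).
rewrite (coord_deriv_sym Freg Gsym (ver b) (hor a)).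
rewrite (ip_sym (J (hor a')) _ Gpos.1) coord_deriv_ver_hor ipDl.
rewrite (phi_skew S_acm Vx (L (hor a) (ver b))) coord_deriv_mixed_phi.
have key (t H l o r : R) : t - (H - l * o) - r = 0 -> t = r + H - l * o by lra.
exact: key.
Qed.

(** Differentiate the fundamental form of the second factor along the first. *)
Lemma phi_deriv_hor_ver a b b' :
  ip G (T (J (hor a)) (J (ver b))) (J (ver b')) =
  cov_slant a b b' + mixed_ff a b b' - mixed_ff a b' b.
Proof.
rewrite /cov_slant /dslant /slant_form.
rewrite (levi_civita_along_metric dF dG Gsym Gpos
  (@dphi_field (hor a) (ver b)) (@dfield (hor a) (ver b'))).
rewrite (nabla_phi_along S_acm Vx dF (@dfield (hor a) (ver b))).
rewrite -/(coord_deriv _ _ _ _ _) -/(coord_deriv _ _ _ _ _) -/(om b b') ipDl.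
rewrite (phi_skew S_acm Vx (L (hor a) (ver b))) coord_deriv_mixed_phi.
rewrite (ip_sym (J (ver b) *m ph) _ Gpos.1) coord_deriv_mixed_phi.
rewrite (slant_form_skew b' b Ux).
have key (t H H' l o : R) :
  t = t - (H - l * o) + (H' - l * - o) - 2 * l * o + H - H' by ring.
exact: key.
Qed.

Context (alpha beta : M -> R) (S_nts : nearly_trans_sasakian S alpha beta).

Local Notation al := (alpha (F (chart_inv c x))).
Local Notation be := (beta (F (chart_inv c x))).

Let nts u v := nearly_trans_sasakian_phi_deriv u v S_acm S_nts Vx.

(** The nearly trans-Sasakian identity only controls the sum of
    [(nabla_X phi) Z] and [(nabla_Z phi) X]; the two lemmas above express both
    by the mixed part of [h]. *)
Lemma nts_mixed a a' b b' : J (hor a) *m ph = J (hor a') ->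
  cov_slant a b b' + 2 * mixed_ff a b b' - mixed_ff a b' b
  + (dlnf a' + al * ip G (J (hor a)) xix) * ip vm b b' =
  (dlnf a - be * ip G (J (hor a)) xix) * om b b'.
Proof.
move=> aa'.
have sum : ip G (T (J (hor a)) (J (ver b)) + T (J (ver b)) (J (hor a))) (J (ver b')) =
    - (al * ip G (J (hor a)) xix * ip vm b b')
    - be * ip G (J (hor a)) xix * om b b'.
  rewrite nts (local_repK M_mfd Ux).
  rewrite (ver_xi b Ux) !scale0r add0r ip_field warped_hor_ver// mulr0 scale0r.
  rewrite subrr sub0r ipDl ipZl !ipNl !ipZl ip_field ip_ver// -/(om b b').
  have key (p q r s t : R) : p * - (q * r) - t * (q * s) = - (p * q * r) - t * q * s.
    by ring.
  exact: key.
have key (t t' q H H' l l' o r A B : R) :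
    t = q + H - H' -> t' = l' * r + H - l * o -> t + t' = - (A * r) - B * o ->
    q + 2 * H - H' + (l' + A) * r = (l - B) * o by move=> -> ->; lra.
exact: (key _ _ _ _ _ _ _ _ _ _ _ (phi_deriv_hor_ver a b b')
  (phi_deriv_ver_hor b b' aa') (etrans (esym (ipDl _ _ _ _)) sum)).
Qed.

(** [xi] acts on vertical vectors like [beta]: pairing the identity for
    [xi] and [Z] with [phi Z] kills [(nabla_xi phi) Z], and leaves
    [g (nabla_Z xi) Z = beta |Z|^2]. *)
Lemma dlnf_xi k (b : 'rV[R]_n2) : xix = J (hor k) -> b != 0 -> dlnf k = be.
Proof.
move=> xik b0; pose Y y := xi S d (Fh y).
have dY : derivable Y x (ver b).
  exact: diff_derivable (differentiable_along dF (xi_differentiable S_acm Vx)).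
pose A := nab (ver b) Y x.
have AZ : ip G A (J (ver b)) = dlnf k * ip vm b b.
  have ortho :
      'D_(ver b) (fun y => ip (gmet S d (Fh y)) (Y y) (ver b *m 'J Fh y)) x = 0.
    transitivity ('D_(ver b) (cst (0 : R) : 'rV[R]_(n1 + n2) -> R) x);
      last exact: derive_cst.
    apply: near_eq_derive; apply: filterS Unear => y Uy.
    rewrite (ip_sym _ _ (gmet_posdef S_acm (warped_in_chart Uy)).1).
    exact: ver_xi.
  move: ortho; rewrite (levi_civita_along_metric dF dG Gsym Gpos dY
    (@dfield (ver b) (ver b))) -/A -/(coord_deriv _ _ _ _ _).
  have -> : Y x = J (hor k) by exact: xik.
  have key (p q m : R) : q = - m -> p + q = 0 -> p = m by lra.
  exact: (key _ _ _ (etrans (ip_sym (J (hor k)) (L (ver b) (ver b)) Gpos.1)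
    (coord_deriv_ver_hor k b b))).
have Tbxi : T (J (ver b)) xix = - (A *m ph).
  have := nabla_phi_along S_acm Vx dF dY; rewrite -/A.
  rewrite levi_civita_along_near0//; last first.
    by apply: filterS Unear => y Uy; exact: (xi_phi S_acm (warped_in_chart Uy)).
  by move=> /esym/eqP; rewrite addr_eq0 => /eqP.
have := nts xix (J (ver b)); rewrite (local_repK M_mfd Ux) Tbxi.
rewrite (ip_sym xix _ Gpos.1) (ver_xi b Ux) (xi_unit S_acm Vx) mulr0 !scale0r.
rewrite !scale1r sub0r add0r => nts_xi.
have Tz : ip G (T xix (J (ver b))) (J (ver b) *m ph) = 0.
  exact: (phi_deriv_horizontal M_mfd S_acm Vx xix (ver_xi b Ux)).
have bb : ip G (J (ver b) *m ph) (J (ver b) *m ph) = ip vm b b.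
  by rewrite (ip_phi S_acm Vx) (ver_xi b Ux) mulr0 subr0 ip_field ip_ver.
have Ab : ip G (A *m ph) (J (ver b) *m ph) = dlnf k * ip vm b b.
  by rewrite (ip_phi S_acm Vx) (ver_xi b Ux) mulr0 subr0 AZ.
have bphb : ip G (J (ver b)) (J (ver b) *m ph) = 0.
  have := phi_skew S_acm Vx (J (ver b)) (J (ver b)).
  rewrite (ip_sym (J (ver b) *m ph) _ Gpos.1).
  have key (r : R) : r = - r -> r = 0 by lra.
  exact: key.
have vb : ip vm b b != 0 by rewrite gt_eqF//; exact: (ver_metric_posdef Ux).2.
move: (J (ver b)) (J (ver b) *m ph) (A *m ph) (T xix (J (ver b)))
  nts_xi Tz bb Ab bphb => z w a t nts_xi tw ww aw zw.
have := congr1 (fun v => ip G v w) nts_xi.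
rewrite !(ipDl, ipNl, ipZl) ip0l tw ww aw zw.
have key (A' B p q : R) : 0 - p * q = A' * (- 0 - 0) - B * q -> p * q = B * q by lra.
by move=> /key/(mulIf vb).
Qed.

(** Along a horizontal line the second factor is only rescaled, so the slant
    condition determines the growth of the length of the fundamental form. *)
Lemma cov_slant_orthogonal a b e : orthonormal_frame vm e ->
  \sum_k cov_slant a b (e k) * om b (e k) = 0.
Proof.
move=> eON; pose w := warp f c; pose r := ip vm b b.
have w0 y : w y != 0 by rewrite gt_eqF// warp_gt0.
have dom k : derivable (fun y => slant_form y b (e k)) x (hor a).
  apply: derivable_ip; last exact: dfield.
    exact: diff_derivable (differentiable_along dF dG).
  exact: dphi_field.
have dw : derivable w x (hor a) by exact: diff_derivable (warp_differentiable Ux).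
pose Phi := \sum_k (fun y => slant_form y b (e k)) * (fun y => slant_form y b (e k)).
pose C := cos theta ^+ 2 * r / w x ^+ 4.
pose Psi := w * w * (w * w) * cst C.
have line : \forall t \near (0 : R), Phi (t *: hor a + x) = Psi (t *: hor a + x).
  have cline : (fun t : R => t *: hor a + x) @ (0 : R) --> x.
    have : (fun t : R => t *: hor a + x) @ (0 : R) --> (0 : R) *: hor a + x.
      apply: cvgD; last exact: cvg_cst.
      exact: scalel_continuous.
    by rewrite scale0r add0r.
  have : \forall t \near (0 : R), U (t *: hor a + x) by exact: (cline _ Unear).
  apply: filterS => t; set y := t *: hor a + x => Uy.
  have ry : rsubmx y = rsubmx x.
    by rewrite /y linearD linearZ/= rsub_hor scaler0 add0r.
  have vmy b1 b2 : ip (ver_metric y) b1 b2 = (w y / w x) ^+ 2 * ip vm b1 b2.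
    rewrite (ver_metricE y) (ver_metricE x) ry mulrA -exprMn.
    by rewrite -/(w y) -/(w x) (divfK (w0 x)).
  (* the rescaled frame is orthonormal at [y] *)
  pose e' k := (w x / w y) *: e k.
  have e'ON : orthonormal_frame (ver_metric y) e'.
    move=> i j; rewrite vmy ipZl ipZr eON.
    have key (p q m : R) : p != 0 -> q != 0 ->
      (p / q) ^+ 2 * (q / p * (q / p * m)) = m by move=> p0 q0; field; rewrite p0.
    exact: key.
  have := slant_form_norm b Uy e'ON; rewrite vmy -/r => sl.
  have e'E k : slant_form y b (e k) = (w y / w x) * slant_form y b (e' k).
    have e'k : ver (n1 := n1) (e' k) = (w x / w y) *: ver (e k).
      by rewrite /ver scale_row_mx scaler0.
    rewrite /slant_form e'k -scalemxAl ipZr mulrA.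
    have -> : w y / w x * (w x / w y) = 1 by rewrite mulrA divfK// divff.
    by rewrite mul1r.
  rewrite /Phi fct_sumE.
  transitivity (\sum_k (w y / w x) ^+ 2 * slant_form y b (e' k) ^+ 2).
    by apply: eq_bigr => k _; rewrite -exprMn -e'E expr2.
  rewrite -mulr_sumr sl.
  have -> : Psi y = w y * w y * (w y * w y) * (cos theta ^+ 2 * r / w x ^+ 4) by [].
  have key (p q m k : R) : q != 0 -> (p / q) ^+ 2 * (m * ((p / q) ^+ 2 * k)) =
      p * p * (p * p) * (m * k / q ^+ 4) by move=> q0; field.
  exact: key (w0 x).
have DPhi : 'D_(hor a) Phi x = \sum_k 2 * (dslant a b (e k) * om b (e k)).
  rewrite /Phi (derive_sum (fun k => derivableM (dom k) (dom k))).
  apply: eq_bigr => k _; rewrite (deriveM (dom k) (dom k)) -/(dslant a b (e k)).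
  have key (p q : R) : p * q + p * q = 2 * (q * p) by ring.
  exact: key.
have DPsi : 'D_(hor a) Psi x = 4 * dlnf a * (cos theta ^+ 2 * r).
  have dww := derivableM dw dw.
  have dwww := derivableM dww dww.
  rewrite /Psi (deriveM dwww (derivable_cst C _ _)) derive_cst (deriveM dww dww).
  rewrite (deriveM dw dw) derive_warp -/(w x) scaler0 add0r /C.
  have key (p q m l : R) : q != 0 -> m / q ^+ 4 * (q * q * (q * (q * l) + q * (q * l)) +
    q * q * (q * (q * l) + q * (q * l))) = 4 * l * m by move=> q0; field.
  exact: key.
have := near_line_derive line; rewrite DPhi DPsi -mulr_sumr => D.
transitivity (\sum_k (dslant a b (e k) * om b (e k) - 2 * dlnf a * om b (e k) ^+ 2)).
  by apply: eq_bigr => k _; rewrite /cov_slant mulrBl expr2 mulrA.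
rewrite sumrB -mulr_sumr (slant_form_norm b Ux eON) -/r.
have key (p l m : R) : 2 * p = 4 * l * m -> p - 2 * l * m = 0 by lra.
exact: key.
Qed.

(** ** The estimate *)

Lemma dslant_skew a b b' : dslant a b b' = - dslant a b' b.
Proof.
have dom : derivable (fun y => slant_form y b' b) x (hor a).
  apply: derivable_ip; last exact: dfield.
    exact: diff_derivable (differentiable_along dF dG).
  exact: dphi_field.
rewrite /dslant -(deriveN dom); apply: near_eq_derive.
by apply: filterS Unear => y Uy; exact: slant_form_skew.
Qed.

Lemma mixed_ff_lower a a' e : orthonormal_frame vm e -> J (hor a) *m ph = J (hor a') ->
  n2%:R * ((dlnf a' + al * ip G (J (hor a)) xix) ^+ 2
           + (dlnf a - be * ip G (J (hor a)) xix) ^+ 2 * (cos theta ^+ 2 / 9))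
  <= \sum_j \sum_k mixed_ff a (e j) (e k) ^+ 2.
Proof.
move=> eON aa'.
apply: (sum_sqr_lower (q := fun j k => cov_slant a (e j) (e k))
  (om := fun j k => om (e j) (e k))) => [j k|j k|j|j|j k].
- rewrite /cov_slant dslant_skew (slant_form_skew (e j) (e k) Ux).
  by rewrite mulrN opprK opprB addrC.
- exact: slant_form_skew.
- exact: cov_slant_orthogonal.
- by rewrite (slant_form_norm (e j) Ux eON) eON eqxx mulr1.
by rewrite -(eON j k); exact: nts_mixed.
Qed.

(** The normal part of [phi b]; its tangential part lies in the second factor
    and is expanded in the frame [e]. *)
Definition slant_normal (e : 'I_n2 -> 'rV[R]_n2) (b : 'rV[R]_n2) : 'rV[R]_n :=
  J (ver b) *m ph - \sum_l om b (e l) *: J (ver (e l)).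

Lemma slant_form_polar b b' e : orthonormal_frame vm e ->
  \sum_l om b (e l) * om b' (e l) = cos theta ^+ 2 * ip vm b b'.
Proof.
move=> eON; have vms := (ver_metric_posdef Ux).1.
have sum : \sum_l om (b + b') (e l) ^+ 2 =
    \sum_l om b (e l) ^+ 2 + \sum_l om b' (e l) ^+ 2
    + 2 * \sum_l om b (e l) * om b' (e l).
  rewrite mulr_sumr -!big_split/=; apply: eq_bigr => l _.
  have -> : om (b + b') (e l) = om b (e l) + om b' (e l).
    rewrite /slant_form -[b]scale1r ver_linear scale1r !mulmxDl ipDl.
    by rewrite scale1r.
  by clear; ring.
move: sum; rewrite !(slant_form_norm _ Ux eON) !ipDl !ipDr (ip_sym b' b vms).
have key (p q r k S' : R) :
  k * (p + q + (q + r)) = k * p + k * r + 2 * S' -> S' = k * q by lra.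
exact: key.
Qed.

Lemma slant_normal_ip e : orthonormal_frame vm e -> forall j k,
  ip G (slant_normal e (e j)) (slant_normal e (e k)) = sin theta ^+ 2 * (j == k)%:R.
Proof.
move=> eON j k.
have tang b m : ip G (slant_normal e b) (J (ver (e m))) = 0.
  rewrite /slant_normal ipDl ipNl ip_suml (bigD1 m)//= big1 ?addr0 => [|l lm].
    by rewrite ipZl ip_field ip_ver// eON eqxx mulr1 subrr.
  by rewrite ipZl ip_field ip_ver// eON (negPf lm) mulr0.
rewrite {2}/slant_normal ipDr ipNr ip_sumr big1 => [|l _]; last first.
  by rewrite ipZr tang mulr0.
rewrite subr0 /slant_normal ipDl ipNl ip_suml (ip_phi S_acm Vx) !ver_xi//.
rewrite mulr0 subr0 ip_field ip_ver//.
have -> : \sum_l ip G (om (e j) (e l) *: J (ver (e l))) (J (ver (e k)) *m ph) =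
    \sum_l om (e j) (e l) * om (e k) (e l).
  apply: eq_bigr => l _; rewrite ipZl; congr (_ * _).
  exact: ip_sym Gpos.1.
rewrite slant_form_polar// eON sin2cos2.
by clear; ring.
Qed.

(** The vectors [slant_normal e (e k)] are orthogonal of length [sin theta]. *)
Lemma mixed_ff_bessel a b e : orthonormal_frame vm e ->
  (sin theta ^+ 2)^-1 * \sum_k mixed_ff a b (e k) ^+ 2 <=
  ip G (h (hor a) (ver b)) (h (hor a) (ver b)).
Proof.
move=> eON.
have s0 : 0 < sin theta ^+ 2.
  have /andP[t0 t2] := wss_theta F_wss.
  rewrite exprn_gt0// sin_gt0_pi// t0/= (lt_le_trans t2)//.
  by rewrite ler_pdivrMr// ler_peMr// ?pi_ge0// ler1n.
have mixedE k : mixed_ff a b (e k) = ip G (h (hor a) (ver b)) (slant_normal e (e k)).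
  rewrite /slant_normal ipDr ipNr ip_sumr big1 ?subr0// => l _.
  by rewrite ipZr (second_ff_normal Freg dG Gsym Gpos Finj) mulr0.
under eq_bigr => k _ do rewrite mixedE.
exact: bessel Gpos s0 (slant_normal_ip eON).
Qed.

Local Notation hm := (g1 c.1 (lsubmx x)).

Let hm_posdef := factor1_posdef Ux.

Lemma ip_hor a a' : ip G (J (hor a)) (J (hor a')) = ip hm a a'.
Proof. by rewrite ip_field warped_hor_hor. Qed.

(** The gradient of [ln f] on the first factor. *)
Definition hor_gradient (e1 : 'I_n1 -> 'rV[R]_n1) : 'rV[R]_n1 :=
  \sum_i dlnf (e1 i) *: e1 i.

Lemma hor_gradientP e1 a : orthonormal_frame hm e1 ->
  ip hm (hor_gradient e1) a = dlnf a.
Proof.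
move=> e1ON; rewrite /hor_gradient ip_suml {2}(frame_expansion a e1ON).
have dlnf0 : dlnf 0 = 0.
  by rewrite /dlnf /hor row_mx0; exact: derive0.
elim/big_rec2: _ => [|i v r _ ->]; first by rewrite dlnf0.
by rewrite dlnf_linear ipZl (ip_sym a _ hm_posdef.1) mulrC.
Qed.

Lemma gradient_hor e1 : orthonormal_frame hm e1 ->
  gradient gI (fun y => ln (warp f c y)) x = hor (hor_gradient e1).
Proof.
move=> e1ON; have gIu := posdef_unitmx gIpos.
apply: tangent_eq => [a|b]; rewrite (gradientP _ lnf_differentiable gIu).
  by rewrite warped_hor_hor// hor_gradientP.
by rewrite derive_lnf_ver warped_hor_ver.
Qed.

Lemma gradient_norm e1 : orthonormal_frame hm e1 ->
  mnorm (gI x) (gradient gI (fun y => ln (warp f c y)) x) ^+ 2 =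
  ip hm (hor_gradient e1) (hor_gradient e1).
Proof.
by move=> e1ON; rewrite (mnorm_sqr _ gIpos) (gradient_hor e1ON) warped_hor_hor.
Qed.

Lemma parseval_sqr e1 v : orthonormal_frame hm e1 ->
  \sum_i ip hm v (e1 i) ^+ 2 = ip hm v v.
Proof.
move=> e1ON; rewrite (parseval v v e1ON); apply: eq_bigr => i _.
by rewrite (ip_sym (e1 i) v hm_posdef.1) expr2.
Qed.

(** By Parseval these are the squared norms of [alpha xi - phi (grad (ln f))]
    and of [grad (ln f) - beta xi], where [xi (ln f) = beta]. *)
Lemma horizontal_sums e1 (ph1 : 'rV[R]_n1 -> 'rV[R]_n1) (b : 'rV[R]_n2) :
    orthonormal_frame hm e1 -> b != 0 ->
    (forall a, J (hor a) *m ph = J (hor (ph1 a))) ->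
  let Q := ip hm (hor_gradient e1) (hor_gradient e1) - be ^+ 2 in
  \sum_i (dlnf (ph1 (e1 i)) + al * ip G (J (hor (e1 i))) xix) ^+ 2 = Q + al ^+ 2 /\
  \sum_i (dlnf (e1 i) - be * ip G (J (hor (e1 i))) xix) ^+ 2 = Q.
Proof.
move=> e1ON b0 ph1E; have [k xik] := xi_hor Ux.
pose gr := hor_gradient e1.
have grk : ip hm gr k = be by rewrite hor_gradientP// (dlnf_xi xik b0).
have kk : ip hm k k = 1 by rewrite -ip_hor -xik (xi_unit S_acm Vx).
have gr_phi a : dlnf (ph1 a) = - ip hm (ph1 gr) a.
  rewrite -(hor_gradientP _ e1ON) -/gr -!ip_hor -!ph1E.
  by rewrite (phi_skew S_acm Vx) opprK.
have phk : ip hm (ph1 gr) k = 0.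
  by rewrite -ip_hor -ph1E -xik (ip_phi_xi S_acm Vx).
have ph2 : ip hm (ph1 gr) (ph1 gr) = ip hm gr gr - be ^+ 2.
  rewrite -[LHS]ip_hor -!ph1E (ip_phi S_acm Vx) ip_hor xik ip_hor grk.
  by rewrite expr2.
have hs := hm_posdef.1.
split.
  transitivity (\sum_i ip hm (al *: k - ph1 gr) (e1 i) ^+ 2).
    apply: eq_bigr => i _; rewrite gr_phi xik ip_hor (ip_sym (e1 i) k hs).
    by rewrite ipDl ipNl ipZl addrC.
  rewrite parseval_sqr// !(ipDl, ipDr, ipNl, ipNr, ipZl, ipZr) kk phk.
  rewrite (ip_sym k (ph1 gr) hs) phk ph2.
  by move: (ip hm gr gr) => r; clear; ring.
transitivity (\sum_i ip hm (gr - be *: k) (e1 i) ^+ 2).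
  apply: eq_bigr => i _; rewrite xik ip_hor (ip_sym (e1 i) k hs).
  by rewrite ipDl ipNl ipZl hor_gradientP.
rewrite parseval_sqr// !(ipDl, ipDr, ipNl, ipNr, ipZl, ipZr) kk grk.
rewrite (ip_sym k gr hs) grk.
by move: (ip hm gr gr) => r; clear; ring.
Qed.

Local Notation hh u v := (ip G (h u v) (h u v)).

(** The norm may be computed in a frame adapted to the two factors, and the
    symmetry of [h] identifies the two mixed blocks. *)
Lemma second_ff_norm2_split e e1 e2 :
    orthonormal_frame (gI x) e -> orthonormal_frame hm e1 ->
    orthonormal_frame vm e2 ->
  second_ff_norm2 (gmet S d) Fh x e =
  \sum_i \sum_j hh (hor (e1 i)) (hor (e1 j))
  + 2 * (\sum_i \sum_j hh (hor (e1 i)) (ver (e2 j)))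
  + \sum_i \sum_j hh (ver (e2 i)) (ver (e2 j)).
Proof.
move=> eON e1ON e2ON.
pose fr (i : 'I_(n1 + n2)) :=
  match fintype.split i with inl i1 => hor (e1 i1) | inr i2 => ver (e2 i2) end.
have frl i : fr (lshift n2 i) = hor (e1 i).
  by rewrite /fr (unsplitK (inl i : 'I_n1 + 'I_n2)).
have frr i : fr (rshift n1 i) = ver (e2 i).
  by rewrite /fr (unsplitK (inr i : 'I_n1 + 'I_n2)).
have frON : orthonormal_frame (gI x) fr.
  move=> i j; rewrite -[i]splitK -[j]splitK.
  case: (fintype.split i) => i'; case: (fintype.split j) => j'; rewrite /= ?frl ?frr.
  - by rewrite warped_hor_hor// e1ON eq_lshift.
  - by rewrite warped_hor_ver// eq_lrshift.
  - by rewrite (ip_sym _ _ gIpos.1) warped_hor_ver// eq_rlshift.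
  - by rewrite ip_ver// e2ON eq_rshift.
rewrite (second_ff_norm2_frame Freg dG Gsym Gpos Finj eON frON) /second_ff_norm2.
rewrite (sum_blocks (fun u v => hh u v) frl frr).
have -> : \sum_i \sum_j hh (ver (e2 i)) (hor (e1 j)) =
    \sum_i \sum_j hh (hor (e1 i)) (ver (e2 j)).
  apply: (etrans (exchange_big _ _ _ _ _ _)); apply: eq_bigr => i _.
  by apply: eq_bigr => j _; rewrite (second_ff_sym Freg Gsym (ver (e2 j))).
have key (A B C : R) : A + B + (B + C) = A + 2 * B + C by ring.
exact: key.
Qed.

Let gr2 := mnorm (gI x) (gradient gI (fun y => ln (warp f c y)) x) ^+ 2.

Definition warped_bound : R :=
  n2%:R * ((2 / 9 * cot theta ^+ 2 + 2 * csc theta ^+ 2) * (gr2 - be ^+ 2) + al ^+ 2).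

Lemma hh_ge0 u v : 0 <= hh u v.
Proof. exact: posdef_ge0. Qed.

Lemma mixed_block_lower e1 e2 : orthonormal_frame hm e1 -> orthonormal_frame vm e2 ->
  warped_bound <= 2 * (\sum_i \sum_j hh (hor (e1 i)) (ver (e2 j))).
Proof.
move=> e1ON e2ON.
have block_ge0 : 0 <= 2 * (\sum_i \sum_j hh (hor (e1 i)) (ver (e2 j))).
  by rewrite mulr_ge0//; apply: sumr_ge0 => i _; apply: sumr_ge0 => j _; exact: hh_ge0.
(* The equation [xi (ln f) = beta] needs a nonzero vertical vector. *)
have [n20|n2gt0] := posnP n2.
  rewrite /warped_bound (_ : n2%:R = 0 :> R) ?mul0r//.
  by rewrite n20.
pose b := e2 (Ordinal n2gt0).
have b0 : b != 0.
  apply/eqP => b0; have := e2ON (Ordinal n2gt0) (Ordinal n2gt0).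
  by rewrite -/b b0 ip0l eqxx => /esym/eqP; rewrite oner_eq0.
have [ph1 ph1E] := boolp.choice (fun a => phi_hor a Ux).
have [mu2 nu2] := horizontal_sums e1ON b0 ph1E.
pose s := sin theta ^+ 2; pose c2 := cos theta ^+ 2.
have s0 : 0 < s.
  have /andP[t0 t2] := wss_theta F_wss.
  rewrite exprn_gt0// sin_gt0_pi// t0/= (lt_le_trans t2)//.
  by rewrite ler_pdivrMr// ler_peMr// ?pi_ge0// ler1n.
pose Q := gr2 - be ^+ 2.
have sums : s^-1 * (n2%:R * (Q + al ^+ 2 + Q * (c2 / 9))) <=
    \sum_i \sum_j hh (hor (e1 i)) (ver (e2 j)).
  have QE : Q = ip hm (hor_gradient e1) (hor_gradient e1) - be ^+ 2.
    by rewrite /Q /gr2 (gradient_norm e1ON).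
  rewrite -QE in mu2 nu2; rewrite -mu2 -[in X in _ + X]nu2 mulr_suml -big_split/=.
  rewrite mulr_sumr mulr_sumr; apply: ler_sum => i _.
  apply: (@le_trans _ _ (s^-1 * \sum_j \sum_k mixed_ff (e1 i) (e2 j) (e2 k) ^+ 2)).
    rewrite ler_pM2l ?invr_gt0//.
    exact: mixed_ff_lower e2ON (ph1E (e1 i)).
  rewrite mulr_sumr; apply: ler_sum => j _.
  exact: mixed_ff_bessel.
have s1 : s <= 1 by rewrite /s sin2cos2 gerBl sqr_ge0.
(* Twice the mixed block carries [2 alpha^2 / sin^2 theta] where the bound only keeps
   [alpha^2]. *)
have bound : warped_bound = 2 * (s^-1 * (n2%:R * (Q + al ^+ 2 + Q * (c2 / 9)))) -
    n2%:R * al ^+ 2 * (2 * s^-1 - 1).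
  rewrite /warped_bound -/Q /cot /csc expr_div_n exprVn -/s -/c2.
  have sn0 : s != 0 by rewrite gt_eqF.
  have key (N A q k r : R) : r != 0 ->
      N * ((2 / 9 * (k / r) + 2 / r) * q + A) =
      2 * (r^-1 * (N * (q + A + q * (k / 9)))) - N * A * (2 / r - 1).
    by move=> r0; field.
  exact: key.
have excess : 0 <= n2%:R * al ^+ 2 * (2 * s^-1 - 1).
  apply: mulr_ge0; first by rewrite mulr_ge0// sqr_ge0.
  have : 1 <= s^-1 by rewrite invf_ge1.
  have key (r : R) : 1 <= r -> 0 <= 2 * r - 1 by lra.
  exact: key.
rewrite bound; move: sums excess.
move: (s^-1 * _) (\sum_i _) (n2%:R * _ * _) => A B C; lra.
Qed.

Lemma warped_estimate e : orthonormal_frame (gI x) e ->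
  warped_bound <= second_ff_norm2 (gmet S d) Fh x e.
Proof.
move=> eON.
have [e1 e1ON] := exists_orthonormal_frame hm_posdef.
have [e2 e2ON] := exists_orthonormal_frame (ver_metric_posdef Ux).
rewrite (second_ff_norm2_split eON e1ON e2ON).
apply: (le_trans (mixed_block_lower e1ON e2ON)).
rewrite -addrA addrCA lerDl addr_ge0//; apply: sumr_ge0 => i _;
  apply: sumr_ge0 => j _; exact: hh_ge0.
Qed.

(** The mixed block alone reaches the bound, so equality leaves nothing for the
    two pure blocks. *)
Lemma warped_equality e : orthonormal_frame (gI x) e ->
    second_ff_norm2 (gmet S d) Fh x e = warped_bound ->
  (forall a a', h (hor a) (hor a') = 0) /\ (forall b b', h (ver b) (ver b') = 0).
Proof.
move=> eON heq.
have [e1 e1ON] := exists_orthonormal_frame hm_posdef.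
have [e2 e2ON] := exists_orthonormal_frame (ver_metric_posdef Ux).
have := mixed_block_lower e1ON e2ON.
rewrite -heq (second_ff_norm2_split eON e1ON e2ON) => le0.
have rows_ge0 (k : nat) (r : 'I_k -> 'rV[R]_(n1 + n2)) i :
    0 <= \sum_j hh (r i) (r j) by apply: sumr_ge0 => j _; exact: hh_ge0.
have block_ge0 (k : nat) (r : 'I_k -> 'rV[R]_(n1 + n2)) :
    0 <= \sum_i \sum_j hh (r i) (r j) by apply: sumr_ge0 => i _; exact: rows_ge0.
have block_eq0 (k : nat) (r : 'I_k -> 'rV[R]_(n1 + n2)) :
    \sum_i \sum_j hh (r i) (r j) = 0 -> forall i j, h (r i) (r j) = 0.
  move=> B0 i j; apply: (posdef_eq0 Gpos).
  have Bi : \sum_j hh (r i) (r j) = 0.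
    exact: (psumr_eq0P (fun i _ => rows_ge0 k r i) B0).
  exact: (psumr_eq0P (fun j _ => hh_ge0 (r i) (r j)) Bi).
have TT := block_ge0 _ (fun i => hor (e1 i)).
have VV := block_ge0 _ (fun i => ver (e2 i)).
have TT0 : \sum_i \sum_j hh (hor (e1 i)) (hor (e1 j)) = 0.
  by move: TT VV le0; move: (\sum_i _) (\sum_i _) (\sum_i _) => p q r; lra.
have VV0 : \sum_i \sum_j hh (ver (e2 i)) (ver (e2 j)) = 0.
  by move: TT VV le0; move: (\sum_i _) (\sum_i _) (\sum_i _) => p q r; lra.
have hl := second_ff_linear Freg dG.
have hll := second_ff_linearl Freg dG Gsym.
split.
  apply: (bilinear_frame_eq0 (b := fun a a' => h (hor a) (hor a'))) e1ON _.
  - by move=> r u v w; rewrite hor_linear hll.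
  - by move=> r u v w; rewrite hor_linear hl.
  - exact: (block_eq0 _ (fun i => hor (e1 i)) TT0).
apply: (bilinear_frame_eq0 (b := fun b b' => h (ver b) (ver b'))) e2ON _.
- by move=> r u v w; rewrite ver_linear hll.
- by move=> r u v w; rewrite ver_linear hl.
- exact: (block_eq0 _ (fun i => ver (e2 i)) VV0).
Qed.

(** ** The second fundamental forms of the factors *)

(** The first factor is totally geodesic in the warped product, so its second
    fundamental form is the restriction of [h]. *)
Lemma leaf1_second_ff a a' : h (hor a) (hor a') = 0 ->
  second_ff (gmet S d) (local_rep (leaf1 F (chart_inv c.2 (rsubmx x))) c.1 d)
    (lsubmx x) a a' = 0.
Proof.
move=> h0; rewrite leaf1_rep; have slE := leaf1_slice x.
pose Gam := christoffel gI x (hor a) (hor a').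
have LE : L (hor a) (hor a') = J Gam.
  by move: h0; rewrite second_ffE => /subr0_eq.
have GamE : Gam = hor (lsubmx Gam).
  apply: tangent_eq => [t|t].
    rewrite {1}[Gam]hor_ver_split ipDl (ip_sym (ver _)) ?gIpos.1//.
    by rewrite warped_hor_ver// addr0.
  by rewrite second_ff_tangential coord_deriv_hor_ver warped_hor_ver.
have Ainj : injective (fun u : 'rV[R]_n1 => u *m (hor_mx : 'M[R]_(n1, n1 + n2))).
  by move=> s t; rewrite !mul_hor_mx => st; rewrite -(lsub_hor n2 s) st lsub_hor.
have := @second_ff_slice R n1 (n1 + n2) n Fh hor_mx (ver (rsubmx x)) (lsubmx x).
rewrite slE => /(_ Freg (gmet S d) dG Gsym Gpos Finj Ainj) slice_ff.
apply: (slice_ff _ _ (lsubmx Gam)).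
  by rewrite addr0 !mul_hor_mx -GamE LE.
by move=> t; rewrite ip0l.
Qed.

(** The fibers of a warped product are umbilical, with mean curvature vector
    minus the gradient of [ln f]. *)
Lemma leaf2_second_ff b b' e1 : orthonormal_frame hm e1 ->
    h (ver b) (ver b') = 0 ->
  second_ff (gmet S d) (local_rep (leaf2 F (chart_inv c.1 (lsubmx x))) c.2 d)
    (rsubmx x) b b' = - ip vm b b' *: J (hor (hor_gradient e1)).
Proof.
move=> e1ON h0; rewrite leaf2_rep; have slE := leaf2_slice x.
pose Gam := christoffel gI x (ver b) (ver b').
pose gr := hor_gradient e1.
have LE : L (ver b) (ver b') = J Gam.
  by move: h0; rewrite second_ffE => /subr0_eq.
have GamE : Gam = ver (rsubmx Gam) + - ip vm b b' *: hor gr.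
  apply: tangent_eq => [t|t]; rewrite ipDl ipZl.
    rewrite second_ff_tangential coord_deriv_ver_hor warped_hor_hor// hor_gradientP//.
    by rewrite (ip_sym (ver _) _ gIpos.1) warped_hor_ver// add0r mulrC mulNr mulrC.
  rewrite warped_hor_ver// mulr0 addr0 {1}[Gam]hor_ver_split ipDl.
  by rewrite warped_hor_ver// add0r.
have Ainj : injective (fun u : 'rV[R]_n2 => u *m (ver_mx : 'M[R]_(n2, n1 + n2))).
  by move=> s t; rewrite !mul_ver_mx => st; rewrite -(rsub_ver n1 s) st rsub_ver.
have := @second_ff_slice R n2 (n1 + n2) n Fh ver_mx (hor (lsubmx x)) (rsubmx x).
rewrite slE => /(_ Freg (gmet S d) dG Gsym Gpos Finj Ainj) slice_ff.
apply: (slice_ff _ _ (rsubmx Gam)).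
  by rewrite !mul_ver_mx LE {1}GamE mulmxDl -scalemxAl.
move=> t; rewrite mul_ver_mx ipZl ip_field warped_hor_ver//.
by rewrite mulr0.
Qed.

Lemma leaf2_induced b b' :
  ip (induced_metric (gmet S d)
        (local_rep (leaf2 F (chart_inv c.1 (lsubmx x))) c.2 d) (rsubmx x)) b b' =
  ip vm b b'.
Proof. by rewrite ip_induced leaf2_point !leaf2_jacobian// ip_field ip_ver. Qed.

(** All the [h (e_i, e_i)] of the second factor equal minus the gradient, so
    the mean curvature vector does too. *)
Lemma leaf2_umbilical e : (forall b b', h (ver b) (ver b') = 0) ->
  let F2 := local_rep (leaf2 F (chart_inv c.1 (lsubmx x))) c.2 d in
  orthonormal_frame (induced_metric (gmet S d) F2 (rsubmx x)) e ->
  forall b b', second_ff (gmet S d) F2 (rsubmx x) b b' =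
    ip (induced_metric (gmet S d) F2 (rsubmx x)) b b'
      *: mean_curvature (gmet S d) F2 (rsubmx x) e.
Proof.
move=> h0 F2 eON b b'.
have [e1 e1ON] := exists_orthonormal_frame hm_posdef.
have hE t t' : second_ff (gmet S d) F2 (rsubmx x) t t' =
    - ip vm t t' *: J (hor (hor_gradient e1)) by exact: leaf2_second_ff e1ON (h0 t t').
rewrite hE leaf2_induced /mean_curvature.
have -> : \sum_i second_ff (gmet S d) F2 (rsubmx x) (e i) (e i) =
    n2%:R *: - J (hor (hor_gradient e1)).
  under eq_bigr => i _ do rewrite hE -leaf2_induced eON eqxx scaleN1r.
  by rewrite sumr_const card_ord scaler_nat.
have [n20|n2gt0] := posnP n2.
  suff -> : ip vm b b' = 0 by rewrite oppr0 !scale0r.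
  have -> : b = 0 by apply/rowP => i; have := ltn_ord i; rewrite {2}n20.
  by rewrite ip0l.
rewrite [_^-1 *: _]scalerA mulVf ?scale1r ?pnatr_eq0 ?gtn_eqF//.
by rewrite scalerN scaleNr.
Qed.

End at_a_point.
End warped_chart.

(** * The theorem *)

(** A chart of the other factor around the fixed point completes [c1] to a chart
    of the product. *)
Lemma leaf1_chart (R : realType) n n1 n2 (M : charted R n) (N1 : charted R n1)
    (N2 : charted R n2) (F : prod_charted N1 N2 -> M) p2 c1 d x1 :
    smooth_manifold N2 -> rep_dom (leaf1 F p2) c1 d x1 ->
  exists c2 (x : 'rV[R]_(n1 + n2)), [/\ rep_dom F (c1, c2) d x, lsubmx x = x1 &
    chart_inv c2 (rsubmx x) = p2].
Proof.
move=> N2_mfd [x1c Fx]; have [c2 p2c] := mfd_cover N2_mfd p2.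
have p2K := mfd_coordK N2_mfd p2c.
exists c2, (row_mx x1 (chart_map c2 p2)); rewrite row_mxKl row_mxKr; split => //.
split; first by apply/chart_img_prodP; rewrite row_mxKl row_mxKr; split=> //; exists p2.
by rewrite /= row_mxKl row_mxKr p2K.
Qed.

Lemma leaf2_chart (R : realType) n n1 n2 (M : charted R n) (N1 : charted R n1)
    (N2 : charted R n2) (F : prod_charted N1 N2 -> M) p1 c2 d x2 :
    smooth_manifold N1 -> rep_dom (leaf2 F p1) c2 d x2 ->
  exists c1 (x : 'rV[R]_(n1 + n2)), [/\ rep_dom F (c1, c2) d x, rsubmx x = x2 &
    chart_inv c1 (lsubmx x) = p1].
Proof.
move=> N1_mfd [x2c Fx]; have [c1 p1c] := mfd_cover N1_mfd p1.
have p1K := mfd_coordK N1_mfd p1c.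
exists c1, (row_mx (chart_map c1 p1) x2); rewrite row_mxKl row_mxKr; split => //.
split; first by apply/chart_img_prodP; rewrite row_mxKl row_mxKr; split=> //; exists p1.
by rewrite /= row_mxKl row_mxKr p1K.
Qed.

Theorem theorem4p1 (R : realType) (m s q : nat)
    (M : charted R m.*2.+1) (NT : charted R s.*2.+1) (Nth : charted R q.*2)
    (S : contact_data M) (alpha beta : M -> R)
    (gT : chart NT -> 'rV[R]_(s.*2.+1) -> 'M[R]_(s.*2.+1))
    (gth : chart Nth -> 'rV[R]_(q.*2) -> 'M[R]_(q.*2))
    (f : NT -> R) (theta : R) (F : prod_charted NT Nth -> M)
    (M_manifold : smooth_manifold M)
    (S_acm : almost_contact_metric S)
    (alpha_smooth : smooth_fun alpha) (beta_smooth : smooth_fun beta)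
    (S_nts : nearly_trans_sasakian S alpha beta)
    (F_wss : warped_semi_slant S gT gth f theta F)
    (xi_NT : forall p2, xi_tangent S (leaf1 F p2)) :
  let lhs c d x e := second_ff_norm2 (gmet S d) (local_rep F c d) x e in
  let rhs (c : chart (prod_charted NT Nth)) d x :=
    let g := induced_metric (gmet S d) (local_rep F c d) in
    let lnf y := ln (f (chart_inv c y).1) in
    let p := F (chart_inv c x) in
    2 * q%:R *
      ((2 / 9 * cot theta ^+ 2 + 2 * csc theta ^+ 2)
         * (mnorm (g x) (gradient g lnf x) ^+ 2 - beta p ^+ 2)
       + alpha p ^+ 2) in
  let frame c d x e :=
    orthonormal_frame (induced_metric (gmet S d) (local_rep F c d) x) e in
  (forall c d x e, rep_dom F c d x -> frame c d x e -> lhs c d x e >= rhs c d x) /\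
  ((forall c d x e, rep_dom F c d x -> frame c d x e -> lhs c d x e = rhs c d x) ->
   (forall p2, totally_geodesic (gmet S) (leaf1 F p2)) /\
   (forall p1, totally_umbilical (gmet S) (leaf2 F p1))).
Proof.
move=> lhs rhs frame.
have rhsE c d x (Ux : rep_dom F c d x) :
    rhs c d x = warped_bound S f theta F c d x alpha beta.
  have dim : 2 * q%:R = (q.*2)%:R :> R by rewrite -mul2n natrM.
  by rewrite /rhs /warped_bound -dim.
split=> [c d x e Ux eON|heq].
  rewrite (rhsE c d x Ux).
  exact: (warped_estimate M_manifold S_acm F_wss xi_NT Ux S_nts eON).
have pure c d x (Ux : rep_dom F c d x) :=
  let: ex_intro e eON :=
    exists_orthonormal_frame (warped_induced_posdef S_acm F_wss Ux) in
  warped_equality M_manifold S_acm F_wss xi_NT Ux S_nts eON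
    (etrans (heq c d x e Ux eON) (rhsE c d x Ux)).
split=> [p2 c1 d x1 x1dom u v|p1 c2 d x2 x2dom e eON u v].
  have [c2 [x [Ux <- <-]]] := leaf1_chart (wss_manifold2 F_wss) x1dom.
  apply: (leaf1_second_ff M_manifold S_acm F_wss Ux).
  exact: (pure _ _ _ Ux).1.
have [c1 [x [Ux xE pE]]] := leaf2_chart (wss_manifold1 F_wss) x2dom.
move: eON; rewrite -xE -pE => eON.
exact: (leaf2_umbilical M_manifold S_acm F_wss Ux (pure _ _ _ Ux).2 eON).
Qed.
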